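(* Let $L/K$ be a finite totally ramified Galois extension of degree $e$ with $L\neq K$, let $\pi_L$ be a uniformizer of $L$ and $f\in E_K^e$ its minimal polynomial over $K$. If $L/K$ is tamely ramified, then $(\mathrm{T}^e_m)$ for $m=u_{L/K}$ is equivalent to the condition $k^\times/(k^\times)^e=1$. If $L/K$ is wildly ramified, then $(\mathrm{T}^e_m)$ for $m=u_{L/K}$ is equivalent to the condition $k/\wp(k)=0$, where $\wp(X):=X^p-X$.
   Context: $K$ is a complete discrete valuation field with residue field $k$ of characteristic $p>0$ ($k$ may be imperfect), $v_K$ is its valuation normalized by $v_K(K^\times)=\mathbb{Z}$, extended uniquely to a fixed algebraic closure $\Omega$ of $K$; all algebraic extensions of $K$ are taken inside $\Omega$. $\mathcal{O}_L$ is the valuation ring of $L$. $E_K^e$ is the set of (monic) Eisenstein polynomials over $K$ of degree $e$. For $g=\sum a_iX^i$, $h=\sum b_iX^i\in E_K^e$ put $v_K(g,h)=\min_{0\le i\le e-1}\{v_K(a_i-b_i)+i/e\}$. For $g\in E_K^e$ put $M_g=K(\pi_g)$ with $\pi_g\in\Omega$ a root of $g$. For a real number $m\ge 0$, property $(\mathrm{T}^e_m)$ (for $f$): for any $g\in E_K^e$, if $v_K(f,g)\ge m$ then there is a $K$-isomorphism $L\cong M_g$. Ramification break: let $G=\mathrm{Gal}(L/K)$. For $\sigma\in G$ put $\mathbf{i}_{L/K}(\sigma)=\inf_{a\in\mathcal{O}_L}v_K(\sigma(a)-a)$ and $G_{(i)}=\{\sigma\in G: \mathbf{i}_{L/K}(\sigma)\ge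 i\}$ for real $i\ge 0$. Let $\widetilde\varphi_{L/K}(i)=\int_0^i \#G_{(t)}\,dt$, $\mathbf{u}_{L/K}(\sigma)=\widetilde\varphi_{L/K}(\mathbf{i}_{L/K}(\sigma))$ and $G^{(u)}=\{\sigma\in G:\mathbf{u}_{L/K}(\sigma)\ge u\}$ for real $u\ge 0$. Then $u_{L/K}=\inf\{u: G^{(u)}=1\}$. *)

(* Defs.v *)
From HB Require Import structures.
From mathcomp Require Import all_boot all_order all_algebra all_fingroup all_field.
From mathcomp Require Import all_classical all_reals all_analysis.

Set Implicit Arguments.
Unset Strict Implicit.
Unset Printing Implicit Defensive.

Import Order.TTheory GRing.Theory Num.Theory.

Local Open Scope classical_set_scope.
Local Open Scope ring_scope.

Section Valuation.
Variables (R : realType) (F : fieldType) (v : F -> \bar R).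

Definition valuation : Prop :=
  [/\ v 0 = +oo%E,
      forall x, x != 0 -> v x \is a fin_num,
      forall x y, v (x * y) = (v x + v y)%E
    & forall x y, (Order.min (v x) (v y) <= v (x + y))%E].

(* The value group of v is (1/d) Z. *)
Definition value_group_inv (d : nat) : Prop :=
  v @` [set x | x != 0] = range (fun n : int => (n%:~R / d%:R : R)%:E).

Definition normalized_discrete_valuation : Prop :=
  valuation /\ value_group_inv 1.

Definition valuation_complete : Prop :=
  forall u : nat -> F,
    (forall N : nat, exists n0 : nat, forall m n : nat,
       (n0 <= m)%N -> (n0 <= n)%N -> (N%:R%:E <= v (u m - u n))%E) ->
    exists l : F, forall N : nat, exists n0 : nat, forall n : nat,
      (n0 <= n)%N -> (N%:R%:E <= v (u n - l))%E.

Definition val_ring : set F := [set x | (0 <= v x)%E].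

Definition val_max_ideal : set F := [set x | (0 < v x)%E].

(* [k] is the residue field of [v]: [res] restricts to a surjective ring
   morphism from the valuation ring onto [k], with kernel the maximal ideal;
   its values outside the valuation ring are irrelevant. *)
Definition is_residue_field (k : fieldType) (res : F -> k) : Prop :=
  [/\ res 1 = 1,
      forall x y, val_ring x -> val_ring y ->
        res (x + y) = res x + res y /\ res (x * y) = res x * res y,
      forall c : k, exists2 x, val_ring x & res x = c
    & forall x, val_ring x -> (res x = 0 <-> val_max_ideal x)].

(* For a discrete valuation: a generator of the maximal ideal. *)
Definition uniformizer (x : F) : Prop :=
  val_max_ideal x /\ forall y, val_max_ideal y -> (v x <= v y)%E.

(* The set E_F^e of monic Eisenstein polynomials of degree e. *)
Definition eisenstein (e : nat) (g : {poly F}) : Prop :=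
  [/\ g \is monic, size g = e.+1,
      forall i : nat, (i < e)%N -> (1 <= v g`_i)%E
    & v g`_0 = 1%E].

Definition poly_val (e : nat) (g h : {poly F}) : \bar R :=
  \big[Order.min/+oo%E]_(i < e) (v (g`_i - h`_i) + (i%:R / e%:R)%:E)%E.

End Valuation.

Section PropertyT.
Variables (R : realType) (K : fieldType) (v : K -> \bar R).
Variables (Omega : fieldType) (iota : {rmorphism K -> Omega}).

(* The subfield K(x) of Omega. *)
Definition adjoin (x : Omega) : set Omega :=
  [set y | forall S : {pred Omega}, divring_closed S ->
     (forall a, iota a \in S) -> x \in S -> y \in S].

(* A K-isomorphism from L onto a subfield M of Omega, seen as a K-embedding
   of L into Omega with image M. *)
Definition K_isomorphic (L : fieldExtType K) (M : set Omega) : Prop :=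
  exists2 tau : {rmorphism L -> Omega},
    forall a : K, tau a%:A = iota a & range tau = M.

Definition property_T (L : fieldExtType K) (e : nat) (f : {poly K}) (m : R)
    : Prop :=
  forall g : {poly K}, eisenstein v e g -> (m%:E <= poly_val v e f g)%E ->
  forall pi_g : Omega, root (map_poly iota g) pi_g ->
  K_isomorphic L (adjoin pi_g).

End PropertyT.

Section Ramification.
Variables (R : realType) (K : fieldType) (L : splittingFieldType K).
(* The extension to L of the valuation v_K; it is not renormalized. *)
Variable vL : L -> \bar R.

Local Notation G := ('Gal({:L} / 1)%g).

Definition ram_i (s : gal_of {:L}) : \bar R :=
  ereal_inf [set vL (s a - a) | a in val_ring vL].

Definition ram_lower (i : R) : {set gal_of {:L}} :=
  [set s in G | (i%:E <= ram_i s)%E]%SET.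

(* [ram_phi +oo] is the integral over the whole half-line, that is +oo, so that
   [ram_u 1 = +oo]. *)
Definition ram_phi (i : \bar R) : \bar R :=
  (\int[lebesgue_measure]_(t in [set t : R | (0 <= t)%R /\ t%:E <= i])
     (#|ram_lower t|%:R)%:E)%E.

Definition ram_u (s : gal_of {:L}) : \bar R := ram_phi (ram_i s).

Definition ram_upper (u : R) : {set gal_of {:L}} :=
  [set s in G | (u%:E <= ram_u s)%E]%SET.

Definition ram_break : R := inf [set u : R | 0 <= u /\ ram_upper u = 1%g].

(* For K complete, the value group of L is (1/e(L/K)) Z, where e(L/K) is the
   ramification index; total ramification means e(L/K) = [L : K]. *)
Definition totally_ramified : Prop := value_group_inv vL (\dim {:L}).

(* Tameness of a totally ramified extension: its residue extension is trivial,
   hence separable, and only the ramification index [L : K] matters. *)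
Definition tamely_ramified (p : nat) : Prop :=
  totally_ramified /\ ~~ (p %| \dim {:L})%N.

Definition wildly_ramified (p : nat) : Prop :=
  totally_ramified /\ (p %| \dim {:L})%N.

End Ramification.

(* Main.v *)
(* Let [pi] be the uniformizer of [L], let [i] be the largest value of
   [v (s pi - pi)] for [s <> 1], reached on the last ramification subgroup [H],
   and choose [h] in [L] with [v h = i].  For a root [x] of [g], [v_K(f, g)] is the
   valuation of [f(x)], the product of the [x - s pi], so that [v_K(f, g) >= u_{L/K}]
   forces [v (x - s pi) >= i] for the conjugate [s pi] closest to [x]; assume that it
   is [pi] and write [x = pi + y h].  Up to a fixed factor of valuation [u_{L/K}],
   [f(x)] is congruent modulo the maximal ideal to [P(y)], where [P] is the product of
   the [Y - theta s], [s] in [H], and [theta s] is the residue of [(s pi - pi) / h].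
   On the other hand [f(x) = f(x) - g(x)] has a leading term [c x^l] with [c] in [K],
   and every residue arises in this way.  So (T) at [u_{L/K}] says that [P] is
   surjective on [k]: if [P(y)] has a preimage in [k], then [y] itself has a residue in
   [k], hence [x] is closer to some uniformizer of [L] than its conjugates are,
   and Newton approximation puts [x] in [L].
   In the wild case [theta] is an injective homomorphism to [(k, +)] and [P] is an
   additive polynomial, a composite of polynomials [Z^p - c^(p-1) Z], so [P] is
   surjective iff [X^p - X] is.  In the tame case [H] is the whole Galois group, [h] can
   be taken to be [pi], and [P] becomes [(Y + 1)^e - 1]. *)
Require Import Defs.
From HB Require Import structures.
From mathcomp Require Import all_boot all_order all_algebra all_fingroup all_field.
From mathcomp Require Import all_classical all_reals all_analysis.
From mathcomp Require Import all_solvable measurable_realfun ring.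

Set Implicit Arguments.
Unset Strict Implicit.
Unset Printing Implicit Defensive.

Import Order.TTheory GRing.Theory Num.Theory.

Local Open Scope ring_scope.

(** * Valuations *)

Section ValuationTheory.
Variables (R : realType) (F : fieldType) (v : F -> \bar R).
Hypothesis Hv : valuation v.

Lemma val0 : v 0 = +oo%E. Proof. by case: Hv. Qed.

Lemma valM x y : v (x * y) = (v x + v y)%E. Proof. by case: Hv. Qed.

Lemma val_fin x : x != 0 -> v x = (fine (v x))%:E.
Proof. by case: Hv => _ h _ _ /h /fineK. Qed.

Lemma val_eqy x : (v x == +oo%E) = (x == 0).
Proof.
have [->|x0] := eqVneq x 0; first by rewrite val0 eqxx.
by rewrite (val_fin x0).
Qed.

Lemma val_neq0 x (r : R) : v x = r%:E -> x != 0.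
Proof. by move=> h; rewrite -val_eqy h. Qed.

Lemma valD x y : (Order.min (v x) (v y) <= v (x + y))%E.
Proof. by case: Hv. Qed.

Lemma val1 : v 1 = 0%E.
Proof.
have := valM 1 1; rewrite mulr1 (val_fin (oner_neq0 _)) -EFinD => -[/eqP].
by rewrite -subr_eq subrr => /eqP <-.
Qed.

Lemma valN1 : v (-1) = 0%E.
Proof.
have := valM (-1) (-1); rewrite mulrNN mulr1 val1.
have h : (-1 : F) != 0 by rewrite oppr_eq0 oner_neq0.
rewrite (val_fin h) -EFinD => -[/esym/eqP].
by rewrite -mulr2n mulrn_eq0 /= => /eqP ->.
Qed.

Lemma valN x : v (- x) = v x.
Proof. by rewrite -mulN1r valM valN1 add0e. Qed.

Lemma val_ltyP x : reflect (x != 0) (v x < +oo)%E.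
Proof. by rewrite ltey val_eqy; apply: idP. Qed.

Lemma valV x : x != 0 -> v x^-1 = (- v x)%E.
Proof.
move=> x0; have := valM x x^-1; rewrite divff // val1.
have xV0 : x^-1 != 0 by rewrite invr_eq0.
rewrite (val_fin x0) (val_fin xV0) -EFinD -EFinN => -[/esym/eqP].
by rewrite addr_eq0 => /eqP ->; rewrite opprK.
Qed.

Lemma val_div x y : y != 0 -> v (x / y) = (v x - v y)%E.
Proof. by move=> y0; rewrite valM valV. Qed.

Lemma valXn x (r : R) n : v x = r%:E -> v (x ^+ n) = (n%:R * r)%:E.
Proof.
move=> h; elim: n => [|n IH]; first by rewrite expr0 val1 mul0r.
by rewrite exprS valM h IH -EFinD -natr1 mulrDl mul1r addrC.
Qed.

Lemma val_le_div x y : y != 0 -> (v y <= v x)%E = (0 <= v (x / y))%E.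
Proof. by move=> y0; rewrite val_div // (val_fin y0) sube_ge0. Qed.

Lemma val_lt_div x y : y != 0 -> (v y < v x)%E = (0 < v (x / y))%E.
Proof. by move=> y0; rewrite val_div // (val_fin y0) sube_gt0. Qed.

Lemma val_leD c x y : (c <= v x)%E -> (c <= v y)%E -> (c <= v (x + y))%E.
Proof. by move=> cx cy; apply: le_trans (valD x y); rewrite le_min cx. Qed.

Lemma val_leB c x y : (c <= v x)%E -> (c <= v y)%E -> (c <= v (x - y))%E.
Proof. by move=> cx cy; apply: val_leD; rewrite ?valN. Qed.

Lemma val_ltD c x y : (c < v x)%E -> (c < v y)%E -> (c < v (x + y))%E.
Proof. by move=> cx cy; apply: lt_le_trans (valD x y); rewrite lt_min cx. Qed.

Lemma val_ltB c x y : (c < v x)%E -> (c < v y)%E -> (c < v (x - y))%E.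
Proof. by move=> cx cy; apply: val_ltD; rewrite ?valN. Qed.

Lemma val_le_sum c (I : Type) (r : seq I) (P : pred I) (G : I -> F) :
  (forall i, P i -> (c <= v (G i))%E) -> (c <= v (\sum_(i <- r | P i) G i))%E.
Proof.
move=> h; elim/big_rec: _ => [|i y Pi IH]; first by rewrite val0 leey.
by apply: val_leD => //; apply: h.
Qed.

Lemma val_lt_sum (c : R) (I : Type) (r : seq I) (P : pred I) (G : I -> F) :
  (forall i, P i -> (c%:E < v (G i))%E) -> (c%:E < v (\sum_(i <- r | P i) G i))%E.
Proof.
move=> h; elim/big_rec: _ => [|i y Pi IH]; first by rewrite val0 ltey.
by apply: val_ltD => //; apply: h.
Qed.

Lemma val_intM x y : (0 <= v x)%E -> (0 <= v y)%E -> (0 <= v (x * y))%E.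
Proof. by move=> *; rewrite valM adde_ge0. Qed.

Lemma val_idealM x y : (0 < v x)%E -> (0 <= v y)%E -> (0 < v (x * y))%E.
Proof. by move=> x0 y0; rewrite valM; apply: lt_le_trans x0 (leeDl _ y0). Qed.

Lemma val_idealMr x y : (0 <= v x)%E -> (0 < v y)%E -> (0 < v (x * y))%E.
Proof. by move=> *; rewrite mulrC val_idealM. Qed.

Lemma val_intX x n : (0 <= v x)%E -> (0 <= v (x ^+ n))%E.
Proof. by move=> h; elim: n => [|n IH]; rewrite ?expr0 ?val1 ?exprS ?val_intM. Qed.

Lemma val_int_prod (I : Type) (r : seq I) (P : pred I) (G : I -> F) :
  (forall i, P i -> (0 <= v (G i))%E) -> (0 <= v (\prod_(i <- r | P i) G i))%E.
Proof.
move=> h; elim/big_rec: _ => [|i y Pi IH]; first by rewrite val1.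
by apply: val_intM => //; apply: h.
Qed.

Lemma val_prod (I : Type) (r : seq I) (P : pred I) (G : I -> F) (g : I -> R) :
  (forall i, P i -> v (G i) = (g i)%:E) ->
  v (\prod_(i <- r | P i) G i) = (\sum_(i <- r | P i) g i)%:E.
Proof.
move=> h; elim/big_rec2: _ => [|i y z Pi IH]; first by rewrite val1.
by rewrite valM h // IH.
Qed.

(** * Congruence modulo the maximal ideal, and equality of leading terms *)

Definition vcong x y := (0 < v (x - y))%E.

Lemma vcong_refl x : vcong x x.
Proof. by rewrite /vcong subrr val0. Qed.

Lemma vcong_sym x y : vcong x y -> vcong y x.
Proof. by rewrite /vcong -valN opprB. Qed.

Lemma vcong_trans y x z : vcong x y -> vcong y z -> vcong x z.
Proof. by rewrite /vcong => xy yz; rewrite -(subrKA y); apply: val_ltD. Qed.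

Lemma vcong0 x : vcong x 0 = (0 < v x)%E.
Proof. by rewrite /vcong subr0. Qed.

Lemma vcong_sub0 x y : vcong x y = vcong (x - y) 0.
Proof. by rewrite /vcong subr0. Qed.

Lemma vcong_int x y : vcong x y -> (0 <= v y)%E -> (0 <= v x)%E.
Proof. by move=> /ltW xy yi; rewrite -(subrK y x); apply: val_leD. Qed.

Lemma vcongD x x' y y' : vcong x x' -> vcong y y' -> vcong (x + y) (x' + y').
Proof. by rewrite /vcong opprD addrACA => h h'; apply: val_ltD. Qed.

Lemma vcongN x x' : vcong x x' -> vcong (- x) (- x').
Proof. by rewrite /vcong -opprD valN. Qed.

Lemma vcongM x x' y y' : (0 <= v x')%E -> (0 <= v y')%E ->
  vcong x x' -> vcong y y' -> vcong (x * y) (x' * y').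
Proof.
move=> xi yi xx yy; have yi' := vcong_int yy yi; rewrite /vcong.
have -> : x * y - x' * y' = (x - x') * y + x' * (y - y').
  by rewrite mulrBl mulrBr addrA subrK.
by apply: val_ltD; [apply: val_idealM | apply: val_idealMr].
Qed.

Lemma vcong_prod (I : Type) (r : seq I) (P : pred I) (G G' : I -> F) :
  (forall i, P i -> (0 <= v (G' i))%E) ->
  (forall i, P i -> vcong (G i) (G' i)) ->
  vcong (\prod_(i <- r | P i) G i) (\prod_(i <- r | P i) G' i).
Proof.
move=> hi h.
suff : (0 <= v (\prod_(i <- r | P i) G' i))%E /\
  vcong (\prod_(i <- r | P i) G i) (\prod_(i <- r | P i) G' i) by case.
elim/big_rec2: _ => [|i y y' Pi [IH IH']]; first by rewrite val1 vcong_refl.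
by split; [rewrite val_intM ?hi | apply: vcongM; rewrite ?hi ?h].
Qed.

Lemma vcongX x x' n : (0 <= v x')%E -> vcong x x' -> vcong (x ^+ n) (x' ^+ n).
Proof.
move=> xi xx; elim: n => [|n IH]; first by rewrite !expr0 vcong_refl.
by rewrite !exprS; apply: vcongM => //; apply: val_intX.
Qed.

Lemma vcong_unit x y : vcong x y -> v y = 0%E -> v x = 0%E.
Proof.
move=> xy y0; apply/le_anti/andP; split.
  rewrite leNgt; apply/negP => xp.
  by have := val_ltB xp xy; rewrite opprB addrCA subrr addr0 y0 ltxx.
by apply: vcong_int xy _; rewrite y0.
Qed.

(** Primality of the maximal ideal. This is how an approximate zero of a split polynomial is
    identified with one of its roots. *)
Lemma vcong_prime (I : Type) (r : seq I) (P : pred I) (G : I -> F) :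
  (forall i, P i -> (0 <= v (G i))%E) ->
  vcong (\prod_(i <- r | P i) G i) 0 -> exists2 i, P i & vcong (G i) 0.
Proof.
move=> hi; rewrite vcong0; elim: r => [|i r IH].
  by rewrite big_nil val1 ltxx.
rewrite big_cons; case: ifP => // Pi; rewrite valM => h.
have [Gi|Gi] := ltP 0%E (v (G i)); first by exists i => //; rewrite vcong0.
have {}Gi : v (G i) = 0%E by apply/le_anti; rewrite Gi hi.
by apply: IH; move: h; rewrite Gi add0e.
Qed.

Lemma vcongV x y : v y = 0%E -> vcong x y -> vcong x^-1 y^-1.
Proof.
move=> y0 xy; have x0 := vcong_unit xy y0.
have xn0 : x != 0 by apply: (@val_neq0 _ 0); rewrite x0.
have yn0 : y != 0 by apply: (@val_neq0 _ 0); rewrite y0.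
rewrite /vcong; have -> : x^-1 - y^-1 = (y - x) * (x * y)^-1.
  by rewrite mulrBl !invfM mulrCA divff // mulr1 mulrA divff // mul1r.
apply: val_idealM; first exact: vcong_sym.
by rewrite valV ?mulf_neq0 // valM x0 y0 add0e oppe0.
Qed.

(* For [y <> 0] this reads: [x] and [y] have the same leading term. *)
Lemma vcong_div1 x y : y != 0 -> vcong (x / y) 1 = (v y < v (x - y))%E.
Proof. by move=> y0; rewrite val_lt_div // mulrBl divff. Qed.

Lemma vcong_div1_val x y : y != 0 -> vcong (x / y) 1 -> v x = v y.
Proof.
move=> y0 h; have := vcong_unit h val1.
have x0 : x != 0.
  by apply/eqP => x0; move: h; rewrite x0 mul0r /vcong sub0r valN1 ltxx.
rewrite val_div // (val_fin x0) (val_fin y0) -EFinB => -[/eqP].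
by rewrite subr_eq0 => /eqP ->.
Qed.

Lemma vsimM x x' y y' : vcong (x / y) 1 -> vcong (x' / y') 1 ->
  vcong ((x * x') / (y * y')) 1.
Proof.
by move=> h h'; rewrite -mulf_div -[1]mulr1; apply: vcongM; rewrite ?val1.
Qed.

Lemma vsimV x y : vcong (x / y) 1 -> vcong (y / x) 1.
Proof. by move=> h; rewrite -invf_div -[1]invr1; apply: vcongV; rewrite ?val1. Qed.

Lemma vsim_trans y x z : y != 0 ->
  vcong (x / y) 1 -> vcong (y / z) 1 -> vcong (x / z) 1.
Proof.
move=> y0 h h'; rewrite -(divfK y0 x) -mulrA -[1]mulr1.
by apply: vcongM; rewrite ?val1.
Qed.

Lemma vsimX x y n : vcong (x / y) 1 -> vcong (x ^+ n / y ^+ n) 1.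
Proof.
by move=> h; rewrite -expr_div_n -(expr1n _ n); apply: vcongX; rewrite ?val1.
Qed.

Lemma vsim_prod (I : Type) (r : seq I) (P : pred I) (G G' : I -> F) :
  (forall i, P i -> vcong (G i / G' i) 1) ->
  vcong ((\prod_(i <- r | P i) G i) / \prod_(i <- r | P i) G' i) 1.
Proof.
move=> h; elim/big_rec2: _ => [|i y y' Pi IH]; first by rewrite divr1 vcong_refl.
by apply: vsimM => //; apply: h.
Qed.

End ValuationTheory.

Arguments vcong {R F} v x y.

Section ValuationComp.
Variables (R : realType) (F E : fieldType) (v : F -> \bar R).
Variable (j : {rmorphism E -> F}).

Lemma valuation_comp : valuation v -> valuation (fun x => v (j x)).
Proof.
move=> Hv; split; first by rewrite rmorph0 val0.
- by move=> x x0; rewrite (val_fin Hv) ?fmorph_eq0.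
- by move=> x y; rewrite rmorphM valM.
by move=> x y; rewrite rmorphD valD.
Qed.
End ValuationComp.

(** * Additive polynomials *)

Section RootsGroup.
Variables (k : fieldType) (gT : finGroupType) (H : {group gT}) (th : gT -> k).

(** For [th] an injective homomorphism from a group to the additive group of [k], this is the
    additive polynomial attached to a finite additive subgroup of [k]. *)
Definition grpoly (A : {set gT}) : {poly k} := \prod_(s in A) ('X - (th s)%:P).

Lemma grpolyE (x : k) : (grpoly H).[x] = \prod_(s in H) (x - th s).
Proof. by rewrite horner_prod; apply: eq_bigr => s _; rewrite hornerXsubC. Qed.

Lemma monic_grpoly : grpoly H \is monic.
Proof. exact: monic_prod_XsubC. Qed.

Lemma size_grpoly : size (grpoly H) = #|H|.+1.
Proof. by rewrite /grpoly -big_enum size_prod_XsubC -cardE. Qed.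

(** The distinct values of [th] are as many roots as the degree allows. The polynomial identities
    below (translation, composition, injective characters) are all obtained from this. *)
Lemma grpoly_unique (P : {poly k}) : {in H &, injective th} ->
  P \is monic -> size P = #|H|.+1 -> {in H, forall s, root P (th s)} ->
  P = grpoly H.
Proof.
move=> inj /monicP lP sP rP.
have := @all_roots_prod_XsubC _ P [seq th s | s in H].
rewrite size_image lP scale1r big_image; apply => //.
  by apply/allP => _ /fintype.imageP[s sH ->]; apply: rP.
by rewrite uniq_rootsE; apply/dinjectiveP.
Qed.

Lemma monic_size_addC (P : {poly k}) (c : k) (n : nat) : (0 < n)%N ->
  P \is monic -> size P = n.+1 ->
  P + c%:P \is monic /\ size (P + c%:P) = n.+1.
Proof.
move=> n0 /monicP lP sP.
have h : (size c%:P < size P)%N.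
  by rewrite sP (leq_ltn_trans (size_polyC_leq1 c)).
by rewrite qualifE /= lead_coefDl // lP eqxx size_polyDl.
Qed.

Hypothesis thM : {in H &, forall s t, th (s * t)%g = th s + th t}.
Hypothesis thinj : {in H, forall s, th s = 0 -> s = 1%g}.

Lemma th1 : th 1%g = 0.
Proof.
have := thM (group1 H) (group1 H); rewrite mulg1 => /eqP.
by rewrite -subr_eq subrr => /eqP.
Qed.

Lemma thV : {in H, forall s, th s^-1%g = - th s}.
Proof.
move=> s sH; apply/eqP; rewrite -addr_eq0 -thM ?groupV // mulVg th1 //.
Qed.

Lemma thX s n : s \in H -> th (s ^+ n)%g = th s *+ n.
Proof.
move=> sH; elim: n => [|n IH]; first by rewrite expg0 th1.
by rewrite expgS thM ?groupX // IH mulrS.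
Qed.

Lemma th_injective : {in H &, injective th}.
Proof.
move=> s t sH tH e; apply/eqP; rewrite eq_mulgV1; apply/eqP.
by apply: thinj; rewrite ?groupM ?groupV // thM ?groupV // thV // e subrr.
Qed.

(** With P = [grpoly H], the left side is P(X + b). At X = [th s], translating the index by [s]
    turns it into P(b); so P(X + b) - P(b) is monic of degree [#|H|] and vanishes on the values of
    [th]. *)
Lemma grpoly_transl (b : k) :
  \prod_(s in H) ('X - (th s - b)%:P) = grpoly H + ((grpoly H).[b])%:P.
Proof.
apply/eqP; rewrite -subr_eq -polyCN; apply/eqP.
have mP : \prod_(s in H) ('X - (th s - b)%:P) \is monic.
  exact: monic_prod_XsubC.
have sP : size (\prod_(s in H) ('X - (th s - b)%:P)) = #|H|.+1.
  rewrite -big_enum /= -(big_map (fun s => th s - b) xpredT (fun z => 'X - z%:P)).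
  by rewrite size_prod_XsubC size_map -cardE.
have [] := monic_size_addC (- (grpoly H).[b]) (cardG_gt0 H) mP sP.
move=> mQ sQ; apply: grpoly_unique => // [|s sH]; first exact: th_injective.
rewrite /root hornerD hornerC horner_prod grpolyE subr_eq0; apply/eqP.
rewrite (reindex_inj (mulgI s)); apply: eq_big => [t|t].
  by rewrite groupMl.
rewrite groupMl // => tH.
by rewrite hornerXsubC thM // opprB opprD addrCA addNKr.
Qed.

Lemma grpolyD (x b : k) :
  (grpoly H).[x + b] = (grpoly H).[x] + (grpoly H).[b].
Proof.
have := congr1 (horner^~ x) (grpoly_transl b); rewrite hornerD hornerC => <-.
rewrite grpolyE horner_prod; apply: eq_bigr => s _.
by rewrite hornerXsubC opprB addrA.
Qed.

Lemma grpoly_th : {in H, forall s, (grpoly H).[th s] = 0}.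
Proof. by move=> s sH; rewrite grpolyE (bigD1 s) //= subrr mul0r. Qed.

Lemma grpolyMn (x : k) n : (grpoly H).[x *+ n] = (grpoly H).[x] *+ n.
Proof.
elim: n => [|n IH]; first by rewrite !mulr0n -th1 grpoly_th ?group1 // th1.
by rewrite !mulrS grpolyD IH.
Qed.

End RootsGroup.

Section ArtinSchreier.
Variables (k : fieldType) (p : nat) (Hp : p \in [pchar k]).
Variables (gT : finGroupType) (th : gT -> k).

(* Both sides are monic of degree [#|H|] and vanish at the values of [th] on [H]. *)
Lemma grpoly_step (W H : {group gT}) (v : gT) :
  {in H &, forall s t, th (s * t)%g = th s + th t} ->
  {in H, forall s, th s = 0 -> s = 1%g} ->
  W \subset H -> #|H| = (p * #|W|)%N -> v \in H -> v \notin W ->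
  (W * <[v]>)%g = H ->
  exists2 c : k, c != 0 & forall x,
    (grpoly th H).[x] = (grpoly th W).[x] ^+ p - c ^+ p.-1 * (grpoly th W).[x].
Proof.
move=> thM thi sWH oH vH vW defH.
have thMW : {in W &, forall s t, th (s * t)%g = th s + th t}.
  by move=> s t sW tW; apply: thM; apply: (fintype.subsetP sWH).
have thiW : {in W, forall s, th s = 0 -> s = 1%g}.
  by move=> s sW; apply: thi; apply: (fintype.subsetP sWH).
have pp := pcharf_prime Hp; have p0 := prime_gt0 pp; have p1 := prime_gt1 pp.
(* With c the value of P_W = [grpoly th W] at [th v], additivity gives P_W(th (w v^i)) = i c, and
   the multiples i c are the roots of Z^p - c^(p-1) Z. Injectivity of [th] and [v \notin W] make c
   nonzero. *)
exists (grpoly th W).[th v].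
  apply/eqP; rewrite grpolyE => /eqP/prodf_eq0[w wW].
  rewrite subr_eq0 => /eqP/(th_injective thM thi vH (fintype.subsetP sWH w wW)).
  by move=> e; rewrite e wW in vW.
set c := _.[_]; set P := grpoly th W => x.
have sP : size (P ^+ p) = #|H|.+1.
  rewrite -[LHS]prednK ?size_exp ?size_grpoly //=; last first.
    by rewrite size_poly_gt0 expf_neq0 // monic_neq0 // monic_grpoly.
  by rewrite oH mulnC.
have lt : (size (- (c ^+ p.-1 *: P)) < size (P ^+ p))%N.
  rewrite sP size_polyN (leq_ltn_trans (size_scale_leq _ _)) // size_grpoly oH.
  by rewrite ltnS ltn_Pmull // cardG_gt0.
suff <- : P ^+ p - c ^+ p.-1 *: P = grpoly th H.
  by rewrite hornerD hornerN hornerZ horner_exp.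
apply: grpoly_unique.
- exact: th_injective thM thi.
- rewrite qualifE /= lead_coefDl //.
  by have /monicP := monic_exp p (monic_grpoly W th) => ->.
- by rewrite size_polyDl.
move=> s; rewrite -defH => /mulsgP[w z wW /cycleP[i ->] ->].
rewrite /root hornerD hornerN hornerZ horner_exp thM ?groupX //; last first.
  exact: (fintype.subsetP sWH).
rewrite (thX thM) // grpolyD // grpoly_th // add0r grpolyMn //.
rewrite -/P -/c -(pFrobenius_autE Hp) pFrobenius_autMn pFrobenius_autE.
by rewrite mulrnAr -exprSr prednK // subrr.
Qed.

(** In characteristic p, [th] forces [H] to be a p-group, so a maximal proper subgroup W has index p
    and P_H is Z^p - c^(p-1) Z composed with P_W. Surjectivity of P_H passes to this outer factor,
    which is X^p - X up to scaling; conversely, induction on the order shows that a composite of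
    such factors is surjective. *)
Lemma grpoly_surj (H : {group gT}) :
  {in H &, forall s t, th (s * t)%g = th s + th t} ->
  {in H, forall s, th s = 0 -> s = 1%g} -> H :!=: 1%g ->
  (forall a : k, exists b : k, a = b ^+ p - b) <->
  (forall a : k, exists b : k, a = (grpoly th H).[b]).
Proof.
have pp := pcharf_prime Hp; have p0 := prime_gt0 pp.
have hpg (G : {group gT}) :
  {in G &, forall s t, th (s * t)%g = th s + th t} ->
  {in G, forall s, th s = 0 -> s = 1%g} -> (p.-group G)%g.
  move=> thM thi; rewrite -pnat_exponent.
  apply: (@pnat_dvd _ p); last by rewrite pnat_id.
  apply/exponentP => s sG; apply: thi; rewrite ?groupX //.
  by rewrite (thX thM) // mulrn_pchar.
have hsub (G : {group gT}) :
  {in G &, forall s t, th (s * t)%g = th s + th t} ->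
  {in G, forall s, th s = 0 -> s = 1%g} -> G :!=: 1%g ->
  exists2 W : {group gT}, W \proper G & exists2 c : k, c != 0 & forall x,
    (grpoly th G).[x] = (grpoly th W).[x] ^+ p - c ^+ p.-1 * (grpoly th W).[x].
  move=> thM thi G1; have pG := hpg _ thM thi.
  have [e|[W mW _]] := maximal_exists (sub1G G).
    by case/eqP: G1; rewrite -e.
  have nW := p_maximal_normal pG mW; have sWG := normal_sub nW.
  have iW := p_maximal_index pG mW; exists W; first exact: maxgroupp mW.
  have /fintype.subsetPn[v vG vW] := proper_subn (maxgroupp mW).
  apply: (grpoly_step thM thi sWG _ vG vW).
    by rewrite -iW mulnC Lagrange.
  by apply: mulg_normal_maximal => //; rewrite cycle_subG.
move=> thM thi H1; split; last first.
  have [W _ [c c0 cE]] := hsub _ thM thi H1 => h a.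
  (* The substitution Z = c t turns Z^p - c^(p-1) Z into c^p (t^p - t). *)
  have [x xE] := h (c ^+ p * a); exists ((grpoly th W).[x] / c).
  apply: (@mulfI _ (c ^+ p)); first by rewrite expf_neq0.
  rewrite xE cE mulrBr -exprMn mulrCA divff // mulr1.
  congr (_ - _); rewrite -{2}(prednK p0) exprSr -mulrA; congr (_ * _).
  by rewrite mulrCA divff // mulr1.
move=> wp; move: {2}#|H| (leqnn #|H|) => n.
elim: n H thM thi {H1} => [|n IH] G thM thi; first by rewrite leqNgt cardG_gt0.
move=> leG a; have [G1|G1] := eqVneq (G : {set gT}) 1%g.
  by exists a; rewrite grpolyE G1 big_set1 (th1 thM) subr0.
have [W ltW [c c0 cE]] := hsub _ thM thi G1.
have sWG := fintype.subsetP (proper_sub ltW).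
(* With t^p - t = a / c^p, it remains to solve P_W(d) = c t. *)
have [||| d dE] := IH W _ _ _ (c * (sval (cid (wp (a / c ^+ p))))).
- by move=> s t sW tW; apply: thM; apply: sWG.
- by move=> s sW; apply: thi; apply: sWG.
- by rewrite -ltnS (leq_trans (proper_card ltW)).
exists d; rewrite cE -dE; case: cid => /= z zE.
rewrite mulrA -exprSr prednK // exprMn -mulrBr -zE mulrCA divff ?mulr1 //.
by rewrite expf_neq0.
Qed.

End ArtinSchreier.

(* An injective character takes [#|G|] distinct values, all roots of the right-hand side. *)
Lemma prod_injective_character (k : fieldType) (gT : finGroupType)
    (G : {group gT}) (z : gT -> k) :
  {in G &, forall s t, z (s * t)%g = z s * z t} ->
  {in G, forall s, z s = 1 -> s = 1%g} -> z 1%g = 1 ->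
  \prod_(s in G) ('X - (z s)%:P) = 'X^#|G| - 1.
Proof.
move=> zM zi z1.
have zV : {in G, forall s, z s * z s^-1%g = 1}.
  by move=> s sG; rewrite -zM ?groupV // mulgV.
have zX s n : s \in G -> z (s ^+ n)%g = z s ^+ n.
  move=> sG; elim: n => [|n IH]; first by rewrite expg0.
  by rewrite expgS zM ?groupX // IH exprS.
symmetry; apply: grpoly_unique.
- move=> s t sG tG e; apply/eqP; rewrite eq_mulgV1; apply/eqP.
  by apply: zi; rewrite ?groupM ?groupV // zM ?groupV // e zV.
- by rewrite monicXnsubC.
- by rewrite size_XnsubC.
by move=> s sG; rewrite /root !hornerE -zX // expg_cardG // z1 subrr.
Qed.

(** * The ramification break *)

Section RamificationBreak.
Variables (R : realType) (K : fieldType) (L : splittingFieldType K).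
Variable vL : L -> \bar R.

Local Notation G := ('Gal({:L} / 1)%g).
Local Notation ri := (ram_i vL).
Local Notation phi := (ram_phi vL).

Hypothesis ri1 : ri 1%g = +oo%E.
Hypothesis ri_gt0 : forall s, s \in G -> (0 < ri s)%E.
Hypothesis ri_fin : forall s, s \in G -> s != 1%g -> (ri s < +oo)%E.

(** The sum over G of min(c, i(s)), a closed form for [ram_phi] at [c]. The case distinction keeps
    it real-valued although i(1) is infinite. *)
Definition ram_trunc (c : R) : R :=
  \sum_(s in G) (if (c%:E <= ri s)%E then c else fine (ri s)).

Local Open Scope classical_set_scope.

Let below (c : \bar R) : set R := [set t : R | (t%:E <= c)%E].

Let below_itv (c : \bar R) : exists i : interval R, below c = [set` i].
Proof.
case: c => [r| |].
- by exists `]-oo, r]%R; apply/seteqP; split => t; rewrite /below /= in_itv /= lee_fin.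
- by exists `]-oo, +oo[%R; apply/seteqP; split => t; rewrite /below /= leey.
by exists `]0, 0[%R; apply/seteqP; split => t; rewrite /below /= ?leeNy_eq // in_itv /= lt_asym.
Qed.

Let measurable_below (c : \bar R) : measurable (below c).
Proof. by have [i ->] := below_itv c; apply: measurable_itv. Qed.

Let domE (c : \bar R) :
  [set t : R | (0 <= t)%R /\ (t%:E <= c)%E] = `[0, +oo[ `&` below c.
Proof.
by apply/seteqP; split => t; rewrite /below /= in_itv /= andbT.
Qed.

Let measurable_dom (c : \bar R) :
  measurable [set t : R | (0 <= t)%R /\ (t%:E <= c)%E].
Proof. by rewrite domE; apply: measurableI => //; apply: measurable_itv. Qed.

Let cardE (t : R) : (#|ram_lower vL t|%:R : R)%:E =
  (\sum_(s <- enum G) (\1_(below (ri s)) t : R)%:E)%E.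
Proof.
rewrite sumEFin -sum1_card natr_sum big_enum big_mkcond [in RHS]big_mkcond /=.
congr (_%:E); apply: eq_bigr => s _; rewrite inE; case: (s \in G) => //=.
rewrite indicE; case: ifP => h; first by rewrite mem_set.
by rewrite memNset // /below /= h.
Qed.

Let measurable_card (D : set R) :
  measurable_fun D (fun t : R => (#|ram_lower vL t|%:R : R)%:E : \bar R).
Proof.
under eq_fun do rewrite cardE.
apply: emeasurable_sum => s.
by apply/measurable_EFinP; apply: measurable_indic.
Qed.

(** The order of the lower group at t is the sum over [s] of the indicators of t <= i(s), so the
    integral over [0, c] is the sum of the lengths of the intervals [0, min(c, i(s))]. *)
Lemma ram_phiE (c : R) : 0 <= c -> phi c%:E = (ram_trunc c)%:E.
Proof.
move=> c0; rewrite /ram_phi.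
under eq_integral do rewrite cardE.
rewrite ge0_integral_sum; first last.
- by move=> s t _; rewrite lee_fin.
- move=> s; apply/measurable_EFinP.
  apply: measurable_indic; exact: measurable_below.
- exact: measurable_dom.
rewrite /ram_trunc -sumEFin -[in RHS]big_enum /=.
apply: eq_big_seq => s; rewrite mem_enum => sG.
rewrite integral_indic; [|exact: measurable_dom|exact: measurable_below].
rewrite domE.
set m := if _ then _ else _.
have m0 : 0 <= m.
  by rewrite /m; case: ifP => // _; rewrite fine_ge0 // ltW // ri_gt0.
have -> : below (ri s) `&` (`[0, +oo[ `&` below c%:E) = `[0, m].
  apply/seteqP; split => t; rewrite /below /= !in_itv /= andbT lee_fin.
    case=> h [-> h']; rewrite /m; case: ifP => //= /negbT; rewrite -ltNge => lt.
    by rewrite -lee_fin fineK // ge0_fin_numE ?(lt_trans lt) ?ltry // ltW ?ri_gt0.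
  move=> /andP[-> tm]; rewrite /m in tm; case: ifP tm => [h tc|/negbT].
    by split=> //; apply: le_trans h; rewrite lee_fin.
  rewrite -ltNge => lt tr.
  have e : ri s = (fine (ri s))%:E.
    by rewrite fineK // ge0_fin_numE ?(lt_trans lt) ?ltry // ltW ?ri_gt0.
  rewrite e lee_fin; split => //; split=> //; apply: (le_trans tr).
  by rewrite -lee_fin -e ltW.
apply: eq_trans; first exact: lebesgue_measure_itv.
rewrite /= lte_fin -EFinB subr0; case: ltP => // m0'.
by congr (_%:E); apply/le_anti; rewrite m0 m0'.
Qed.

(** The identity alone contributes [c]. *)
Lemma ram_trunc_ge (c : R) : 0 <= c -> c <= ram_trunc c.
Proof.
move=> c0; rewrite /ram_trunc (bigD1 1%g) ?group1 //= ri1 leey lerDl.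
apply: sumr_ge0 => s /andP[sG _]; case: ifP => // _.
by rewrite fine_ge0 // ltW // ri_gt0.
Qed.

Lemma ram_trunc_mono (c d : R) : 0 <= c -> c <= d -> ram_trunc c <= ram_trunc d.
Proof.
move=> c0 cd; apply: ler_sum => s sG.
case: ifP => h; case: ifP => h' //.
  rewrite -lee_fin fineK // ge0_fin_numE ?ltW ?ri_gt0 //.
  by move/negbT: h'; rewrite -ltNge => /lt_trans -> //; rewrite ltry.
by case/negP: (negbT h); apply: le_trans h'; rewrite lee_fin.
Qed.

Lemma ram_u1 : ram_u vL 1%g = +oo%E.
Proof.
rewrite /ram_u ri1; apply/eqyP => c c0.
apply: (@le_trans _ _ (phi c%:E)).
  by rewrite ram_phiE ?lee_fin ?ram_trunc_ge // ltW.
apply: ge0_subset_integral.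
- exact: measurable_dom.
- exact: measurable_dom.
- exact: measurable_card.
- by move=> t _; rewrite lee_fin.
by move=> t [t0 _]; split=> //; rewrite leey.
Qed.

(** Since [ram_trunc] is nondecreasing, the upper numbers of the s <> 1 are at most [ram_trunc c],
    which is reached at [s0]. The upper group is therefore trivial exactly on the open half-line
    beyond this value. *)
Lemma ram_breakE (s0 : gal_of {:L}) (c : R) : s0 \in G -> s0 != 1%g ->
  ri s0 = c%:E -> {in G, forall s, s != 1%g -> (ri s <= c%:E)%E} ->
  ram_break vL = ram_trunc c.
Proof.
move=> s0G s01 s0c smax; have c0 : 0 <= c.
  by rewrite -lee_fin -s0c ltW // ri_gt0.
rewrite /ram_break.
have -> : [set u : R | (0 <= u)%R /\ ram_upper vL u = 1%g] =
          [set u : R | (ram_trunc c < u)%R].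
  apply/seteqP; split => u /=.
    case=> u0 /setP/(_ s0); rewrite !inE s0G (negbTE s01) /= /ram_u s0c.
    by rewrite ram_phiE // lee_fin leNgt => /negbFE.
  move=> cu; split; first by rewrite (le_trans (le_trans c0 (ram_trunc_ge c0))) ?ltW.
  apply/setP => s; rewrite !inE; have [->|s1] := eqVneq s 1%g.
    by rewrite group1 ram_u1 leey.
  apply/negbTE; rewrite negb_and; case sG: (s \in G) => //=.
  have e : ri s = (fine (ri s))%:E.
    by rewrite fineK // ge0_fin_numE ?ri_fin // ltW ?ri_gt0.
  have r0 : 0 <= fine (ri s) by rewrite -lee_fin -e ltW // ri_gt0.
  rewrite -ltNge /ram_u e ram_phiE // lte_fin (le_lt_trans _ cu) //.
  by apply: ram_trunc_mono => //; rewrite -lee_fin -e smax.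
have -> : [set u : R | (ram_trunc c < u)%R] = [set` `]ram_trunc c, +oo[%R].
  by apply/seteqP; split => u /=; rewrite in_itv /= andbT.
by rewrite inf_itv.
Qed.

End RamificationBreak.

(** * Totally ramified extensions *)

Section TotallyRamifiedExpansion.
Variables (R : realType) (K E : fieldType) (vK : K -> \bar R) (u : E -> \bar R).
Variable (h : {rmorphism K -> E}).
Hypotheses (HvK : normalized_discrete_valuation vK) (Hu : valuation u).
Hypothesis Huh : forall a, u (h a) = vK a.

Lemma valK_int a : a != 0 -> exists n : int, vK a = (n%:~R)%:E.
Proof.
case: HvK => _ /seteqP[sub _] a0.
have [|n _ hn] := sub (vK a); first by exists a.
by exists n; move: hn; rewrite divr1 => <-.
Qed.

Lemma valK_ex (n : int) : exists2 a, a != 0 & vK a = (n%:~R)%:E.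
Proof.
case: HvK => _ /seteqP[_ sub].
have [|a a0 ha] := sub ((n%:~R / 1%:R : R)%:E); first by exists n.
by exists a => //; rewrite ha divr1.
Qed.

Variables (e : nat) (x : E).
Hypotheses (e0 : (0 < e)%N) (ux : u x = (e%:R^-1)%:E).

Lemma val_term (a : K) (i : nat) (n : int) : vK a = (n%:~R)%:E ->
  u (h a * x ^+ i) = (n%:~R + i%:R / e%:R)%:E.
Proof. by move=> va; rewrite (valM Hu) Huh va (valXn Hu _ ux) -EFinD. Qed.

Lemma val_termE (a : K) (i : nat) :
  u (h a * x ^+ i) = (vK a + (i%:R / e%:R)%:E)%E.
Proof. by rewrite (valM Hu) Huh (valXn Hu _ ux). Qed.

Let eR : (0 : R) < e%:R. Proof. by rewrite ltr0n. Qed.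

(** The class of n + i/e modulo the integers determines i < e. *)
Lemma val_term_inj (a b : K) (i l : 'I_e) : a != 0 -> b != 0 ->
  u (h a * x ^+ i) = u (h b * x ^+ l) -> i = l.
Proof.
move=> /valK_int[n va] /valK_int[m vb]; rewrite (val_term _ va) (val_term _ vb).
move=> -[] /(congr1 (fun t => t * e%:R)); rewrite !mulrDl !divfK ?gt_eqF //.
move=> H0; have H : n * Posz e + Posz i = m * Posz e + Posz l.
  by apply: (@intr_inj R); rewrite !intrD !intrM.
apply/val_inj => /=.
have : (Posz i = Posz l %[mod Posz e])%Z.
  by rewrite -[LHS](modzMDl n) H modzMDl.
by rewrite !modz_nat !modn_small // => -[].
Qed.

(** Nonzero terms have pairwise distinct valuations, so one of them is strictly smallest and is the
    leading term of the sum. *)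
Lemma dominant (c : 'I_e -> K) :
  (forall i, c i = 0) \/
  exists l, [/\ c l != 0%R,
    u (h (c l) * x ^+ l) < u (\sum_i h (c i) * x ^+ i - h (c l) * x ^+ l),
    u (\sum_i h (c i) * x ^+ i) = u (h (c l) * x ^+ l)
  & forall i, u (h (c l) * x ^+ l) <= u (h (c i) * x ^+ i)]%E.
Proof.
have x0 : x != 0 by apply: (val_neq0 Hu ux).
case: (pickP (fun i => c i != 0)) => [i0 ci0|H]; last first.
  by left=> i; have /negbFE/eqP := H i.
right; pose F i := fine (u (h (c i) * x ^+ i)).
have FE i : c i != 0 -> u (h (c i) * x ^+ i) = (F i)%:E.
  by move=> ci; rewrite /F -(val_fin Hu) // mulf_neq0 ?fmorph_eq0 ?expf_neq0.
case: (@arg_minP _ _ _ i0 (fun i => c i != 0) F ci0) => l cl lmin.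
have lt : (u (h (c l) * x ^+ l) < u (\sum_i h (c i) * x ^+ i - h (c l) * x ^+ l))%E.
  rewrite (bigD1 l) //= addrAC subrr add0r (FE _ cl).
  apply: (val_lt_sum Hu) => i il.
  have [ci|ci] := eqVneq (c i) 0; first by rewrite ci rmorph0 mul0r (val0 Hu) ltey.
  rewrite (FE _ ci) lte_fin lt_neqAle lmin // andbT.
  apply: contra_neq il => Fe; apply: (val_term_inj ci cl).
  by rewrite !FE // Fe.
exists l; split=> //.
  have t0 : h (c l) * x ^+ l != 0 by rewrite mulf_neq0 ?fmorph_eq0 ?expf_neq0.
  by apply: (vcong_div1_val Hu) => //; rewrite (vcong_div1 Hu).
move=> i; have [ci|ci] := eqVneq (c i) 0; first by rewrite ci rmorph0 mul0r (val0 Hu) leey.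
by rewrite !FE // lee_fin lmin.
Qed.

Lemma expansion_le (c : 'I_e -> K) (r : \bar R) :
  (r <= u (\sum_i h (c i) * x ^+ i))%E =
  [forall i : 'I_e, (r <= vK (c i) + (i%:R / e%:R)%:E)%E].
Proof.
apply/idP/forallP => [H i|H]; last first.
  by apply: (val_le_sum Hu) => i _; rewrite val_termE.
rewrite -val_termE; case: (dominant c) => [c0|[l [_ _ lE lmin]]].
  by rewrite c0 rmorph0 mul0r (val0 Hu) leey.
by apply: le_trans (lmin i); rewrite -lE.
Qed.

Lemma expansion_eq0 (c : 'I_e -> K) :
  \sum_i h (c i) * x ^+ i = 0 -> forall i, c i = 0.
Proof.
move=> H; case: (dominant c) => // -[l [cl _ lE _]].
have x0 : x != 0 by apply: (val_neq0 Hu ux).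
move/eqP: lE; rewrite H (val0 Hu) eq_sym (val_eqy Hu) mulf_eq0 expf_eq0.
by rewrite fmorph_eq0 (negbTE cl) (negbTE x0) andbF.
Qed.

Lemma monic_horner_sub (f g : {poly K}) : f \is monic -> g \is monic ->
  size f = e.+1 -> size g = e.+1 -> root (map_poly h g) x ->
  (map_poly h f).[x] = \sum_(i < e) h (f`_i - g`_i) * x ^+ i.
Proof.
move=> /monicP + /monicP + sf sg /rootP rg; rewrite !lead_coefE sf sg /= => mf mg.
rewrite -[LHS]subr0 -[X in _ - X = _]rg !horner_coef !size_map_poly sf sg !big_ord_recr /=.
rewrite !coef_map mf mg.
rewrite opprD addrACA subrr addr0 -sumrB; apply: eq_bigr => i _.
by rewrite !coef_map rmorphB mulrBl.
Qed.

(** The summand i/e in v_K(f, g) is the valuation of x^i, so v_K(f, g) is the valuation of the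
    expansion f(x) - g(x), where g(x) = 0. *)
Lemma poly_valE (f g : {poly K}) : f \is monic -> g \is monic ->
  size f = e.+1 -> size g = e.+1 -> root (map_poly h g) x ->
  poly_val vK e f g = u (map_poly h f).[x].
Proof.
move=> mf mg sf sg rg; rewrite (monic_horner_sub mf mg sf sg rg).
have H r : (r <= poly_val vK e f g)%E = (r <= u (\sum_(i < e) h (f`_i - g`_i) * x ^+ i))%E.
  rewrite (expansion_le (fun i => f`_i - g`_i)) /poly_val.
  apply/idP/forallP => [H i|H].
    by apply: le_trans H _; apply: bigmin_le.
  by apply: le_bigmin => //; rewrite leey.
by apply/le_anti; rewrite H lexx -H lexx.
Qed.

End TotallyRamifiedExpansion.

(** * Roots of Eisenstein polynomials *)

Section EisensteinRoots.
Variables (R : realType) (K E : fieldType) (vK : K -> \bar R) (u : E -> \bar R).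
Variable (h : {rmorphism K -> E}).
Hypotheses (Hu : valuation u) (Huh : forall a, u (h a) = vK a).

(** Isolate x^e in g(x) = 0 and let r be the valuation of x. If r <= 0, every other term has
    valuation greater than e r, which is absurd; so r > 0, the constant term dominates the others,
    and e r = 1. *)
Lemma eisenstein_root_val (e : nat) (g : {poly K}) (x : E) : (0 < e)%N ->
  eisenstein vK e g -> root (map_poly h g) x -> u x = (e%:R^-1)%:E.
Proof.
move=> e0 [/monicP + sg gi g0] /rootP; rewrite lead_coefE sg /= => mg.
rewrite horner_coef size_map_poly sg.
rewrite big_ord_recr /= coef_map /= mg rmorph1 mul1r => H.
have x0 : x != 0.
  apply/eqP => x0; move: H; rewrite x0 expr0n gtn_eqF // addr0.
  rewrite -(prednK e0) big_ord_recl expr0 mulr1 big1 ?addr0 => [|i _].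
    move=> /(congr1 u); rewrite coef_map Huh g0 (val0 Hu); discriminate.
  by rewrite expr0n mulr0.
pose r := fine (u x); have ur : u x = r%:E by rewrite (val_fin Hu).
have {}H : x ^+ e = - \sum_(i < e) h g`_i * x ^+ i.
  apply/eqP; rewrite -addr_eq0 addrC -[X in _ == X]H; apply/eqP; congr (_ + _).
  by apply: eq_bigr => i _; rewrite coef_map.
have eR : (0 : R) < e%:R by rewrite ltr0n.
have r0 : 0 < r.
  rewrite ltNge; apply/negP => r0.
  have : ((e%:R * r)%:E < u (x ^+ e))%E.
    rewrite H (valN Hu); apply: (val_lt_sum Hu) => i _.
    rewrite (valM Hu) Huh (valXn Hu _ ur).
    apply: (@lt_le_trans _ _ (1 + (i%:R * r)%:E)%E); last first.
      by apply: leeD2r; apply: gi.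
    rewrite -EFinD lte_fin -ltrBlDr -mulrBl.
    apply: le_lt_trans ltr01; rewrite mulr_ge0_le0 // subr_ge0 ler_nat ltnW //.
  by rewrite (valXn Hu _ ur) ltxx.
have : u (x ^+ e) = 1%E.
  rewrite H (valN Hu) -(prednK e0) big_ord_recl expr0 mulr1 -[RHS]g0 -Huh.
  have g00 : h g`_0 != 0 by apply: (@val_neq0 _ _ _ Hu _ 1); rewrite Huh.
  apply: (vcong_div1_val Hu) => //; rewrite (vcong_div1 Hu) // addrAC subrr add0r Huh g0.
  apply: (val_lt_sum Hu) => i _; rewrite (valM Hu) Huh (valXn Hu _ ur).
  apply: (@lt_le_trans _ _ (1 + (i.+1%:R * r)%:E)%E); last first.
    by apply: leeD2r; apply: gi; rewrite /= -[X in (_ < X)%N](prednK e0) ltnS.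
  by rewrite -EFinD lte_fin ltrDl mulr_gt0 // ltr0n.
rewrite (valXn Hu _ ur) ur => -[] er; congr (_%:E).
by apply: (@mulfI _ e%:R); rewrite ?gt_eqF // er divff // gt_eqF.
Qed.

End EisensteinRoots.

(** * Totally ramified Galois extensions: conjugates, completeness, approximation *)

Section TotallyRamifiedGalois.
Variables (R : realType) (K : fieldType) (vK : K -> \bar R).
Hypotheses (HvK : normalized_discrete_valuation vK).
Variables (Omega : fieldType) (iota : {rmorphism K -> Omega}).
Variables (v : Omega -> \bar R) (Hv : valuation v).
Hypothesis Hext : forall a : K, v (iota a) = vK a.
Variables (L : splittingFieldType K) (j : {rmorphism L -> Omega}).
Hypothesis Hj : forall a : K, j a%:A = iota a.
Hypothesis HGal : galois 1%VS {:L}%VS.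
Variable e : nat.
Hypothesis He : \dim {:L}%VS = e.
Hypothesis Htot : totally_ramified (fun x : L => v (j x)).

Local Notation w := (fun x : L => v (j x)).
Local Notation G := ('Gal({:L} / 1)%g).
Local Notation ia := (in_alg L).

Let e0 : (0 < e)%N. Proof. by rewrite -He adim_gt0. Qed.
Let eR : (0 : R) < e%:R. Proof. by rewrite ltr0n. Qed.

Let Hw : valuation w. Proof. exact: valuation_comp. Qed.

Let HvKv : valuation vK. Proof. by case: HvK. Qed.

Let w_ia a : w (ia a) = vK a. Proof. by rewrite /= Hj. Qed.

Lemma card_gal : #|G| = e.
Proof. by rewrite -(galois_dim HGal) dimv1 divn1. Qed.

Lemma galMe (s t : gal_of {:L}) x : (s * t)%g x = t (s x).
Proof. by rewrite galM ?memvf. Qed.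

Lemma totram_val x : x != 0 -> exists n : int, v (j x) = (n%:~R / e%:R)%:E.
Proof.
have /seteqP[sub _] := Htot; rewrite He in sub => x0.
have [|n _ hn] := sub (v (j x)); first by exists x.
by exists n; rewrite hn.
Qed.

Lemma totram_uniformizer x : uniformizer w x -> v (j x) = (e%:R^-1)%:E.
Proof.
have /seteqP[_ sub] := Htot; rewrite He in sub.
have [|y y0 hy] := sub ((1%:~R / e%:R : R)%:E); first by exists 1.
case; rewrite /val_max_ideal /= => x_gt0 xmin.
have := xmin y; rewrite /= hy lte_fin divr_gt0 // => /(_ isT) xy.
have x0 : x != 0.
  by apply: contraTneq xy => ->; rewrite (val0 Hw) leye_eq.
have [n hn] := totram_val x0; rewrite hn in x_gt0 xy *.
move: x_gt0 xy; rewrite lte_fin lee_fin pmulr_lgt0 ?invr_gt0 // ltr0z.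
rewrite ler_pM2r ?invr_gt0 // ler_int gtz0_ge1 => n1 n1'.
have -> : n = 1 by apply/le_anti; rewrite n1 n1'.
by rewrite div1r.
Qed.

(** This is the characteristic polynomial of [a]; G permutes its roots, so its coefficients lie in
    K. *)
Lemma conj_poly (a : L) : exists F : {poly K},
  [/\ F \is monic, size F = e.+1
    & forall x : Omega, (map_poly iota F).[x] = \prod_(s in G) (x - j (s a))].
Proof.
set P := \prod_(s in G) ('X - (s a)%:P).
have sP : size P = e.+1.
  rewrite /P -big_enum /= -(big_map (fun s : gal_of {:L} => s a) xpredT (fun z => 'X - z%:P)).
  by rewrite size_prod_XsubC size_map -cardE card_gal.
have mP : P \is monic by apply: monic_prod_XsubC.
have fP : P \is a polyOver 1%VS.
  apply/polyOverP => i; move/galois_fixedField: HGal => /= <-.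
  apply/fixedFieldP => [|t tG]; first exact: memvf.
  have -> : t P`_i = (map_poly t P)`_i by rewrite coef_map.
  congr ((polyseq _)`_i); rewrite /P rmorph_prod [RHS](reindex_inj (mulIg t)) /=.
  apply: eq_big => [s|s sG]; first by rewrite groupMr.
  by rewrite rmorphB /= map_polyX map_polyC /= galMe.
have [F FE] := polyOver1P fP.
have iaF : map_poly iota F = map_poly j P.
  rewrite FE -map_poly_comp; apply: eq_map_poly => b /=.
  by rewrite Hj.
exists F; split.
- by rewrite -(map_monic ia) -FE.
- by rewrite -(size_map_poly ia) -FE.
move=> x; rewrite iaF /P rmorph_prod horner_prod; apply: eq_bigr => s _.
by rewrite rmorphB /= map_polyX map_polyC hornerXsubC.
Qed.

Section WithUniformizer.
Variable pi : L.
Hypothesis wpi : v (j pi) = (e%:R^-1)%:E.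

(** No nontrivial expansion vanishes, so the [e] powers of [pi] are independent and form a basis by
    dimension. *)
Lemma totram_expansion (x : L) :
  exists c : 'I_e -> K, x = \sum_i ia (c i) * pi ^+ i.
Proof.
pose X := [tuple pi ^+ i | i < e].
have XE (c : 'I_e -> K) : \sum_i c i *: X`_i = \sum_i ia (c i) * pi ^+ i.
  by apply: eq_bigr => i _; rewrite -tnth_nth tnth_mktuple mulr_algl.
have fX : free X.
  apply/freeP => c; rewrite XE => H i.
  exact: (expansion_eq0 HvK Hw w_ia e0 wpi H).
have bX : basis_of {:L} X by rewrite basisEfree fX subvf size_tuple He leqnn.
exists (fun i => coord X i x); rewrite -(XE (fun i => coord X i x)).
exact: (coord_basis bX (memvf x)).
Qed.

Lemma totram_le (c : 'I_e -> K) (r : \bar R) :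
  (r <= v (j (\sum_i ia (c i) * pi ^+ i)%R))%E =
  [forall i : 'I_e, (r <= vK (c i) + (i%:R / e%:R)%:E)%E].
Proof. exact: (expansion_le HvK Hw w_ia e0 wpi). Qed.

(** For [a] nonzero, [vK a] is an integer greater than -1, because i / e < 1. *)
Lemma totram_int_coef (a : K) (i : 'I_e) :
  (0 <= vK a + (i%:R / e%:R)%:E)%E -> (0 <= vK a)%E.
Proof.
have [->|/(valK_int HvK)[n ->]] := eqVneq a 0; first by rewrite (val0 HvKv) leey.
rewrite -EFinD !lee_fin ler0z => h.
rewrite leNgt -lezD1; apply/negP => n0; move: h; apply/negP.
rewrite -ltNge -(opprK (i%:R / e%:R)) subr_lt0.
apply: (@le_lt_trans _ _ (-1)).
  by rewrite -(ler_int R) rmorphD /= -lerBrDr sub0r in n0.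
by rewrite ltrN2 ltr_pdivrMr // mul1r ltr_nat.
Qed.

(** The residue extension is trivial: in the expansion of an integral element all coefficients are
    integral, and the terms with i > 0 lie in the maximal ideal. *)
Lemma totram_residue (x : L) : (0 <= v (j x))%E ->
  exists2 a, (0 <= vK a)%E & vcong v (j x) (iota a).
Proof.
have [c ->] := totram_expansion x; rewrite totram_le => /forallP H.
pose i0 := Ordinal e0; exists (c i0).
  by have := H i0; rewrite mul0r adde0.
rewrite /vcong -Hj -rmorphB -[(c i0)%:A]mulr1 -(expr0 pi).
rewrite (bigD1 i0) //= addrAC subrr add0r; apply: (val_lt_sum Hw) => i ii0.
have i_gt0 : (0 < i)%N by rewrite lt0n.
rewrite (val_termE Hw w_ia wpi); have := H i.
move/totram_int_coef; have [->|/(valK_int HvK)[n ->]] := eqVneq (c i) 0.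
  by rewrite (val0 HvKv) ltey.
rewrite -EFinD lee_fin lte_fin => n0.
by rewrite ltr_wpDl // divr_gt0 // ltr0n.
Qed.

(** Uniqueness of extensions of valuations is bypassed: [x] in powers of [pi] and [s x] in powers of
    [s pi] have the same coefficients, and the valuation depends only on these. *)
Lemma gal_val (s : gal_of {:L}) x : v (j (s pi)) = (e%:R^-1)%:E -> v (j (s x)) = v (j x).
Proof.
have [c ->] := totram_expansion x => wspi.
have sE : s (\sum_i ia (c i) * pi ^+ i) = \sum_i ia (c i) * (s pi) ^+ i.
  by rewrite rmorph_sum; apply: eq_bigr => i _; rewrite rmorphM rmorphXn /= rmorph_alg.
have H r : (r <= w (s (\sum_i ia (c i) * pi ^+ i)%R))%E = (r <= w (\sum_i ia (c i) * pi ^+ i)%R)%E.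
  rewrite sE totram_le.
  exact: (expansion_le HvK Hw w_ia e0 wspi).
by apply/le_anti; rewrite H lexx -H lexx.
Qed.

End WithUniformizer.

(* Here [d] is the ratio of the leading term of [F(x) = F(x) - g(x)], where [F] is the
   characteristic polynomial of [a], to the product of the [a - s a], [s <> 1]. *)
Lemma newton_step (g : {poly K}) (x : Omega) (a : L) :
  eisenstein vK e g -> root (map_poly iota g) x -> v (j a) = (e%:R^-1)%:E ->
  ((e%:R^-1)%:E < v (x - j a))%E ->
  {in G, forall s : gal_of {:L}, s != 1%g -> (v (j (a - s a)%R) < v (x - j a))%E} ->
  x = j a \/ exists d, [/\ d != 0, v (x - j a) = v (j d)
                       & (v (x - j a) < v (x - j (a + d)%R))%E].
Proof.
move=> gE rg wa xa near; have vx := eisenstein_root_val Hv Hext e0 gE rg.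
have [mg sg _ _] := gE; have [F [mF sF FE]] := conj_poly a.
have [->|x_a] := eqVneq x (j a); [by left | right].
have xa0 : x - j a != 0 by rewrite subr_eq0.
have a0 : a != 0 by apply: (val_neq0 Hw wa).
have ja0 : j a != 0 by rewrite fmorph_eq0.
pose D := \prod_(s in G | s != 1%g) (a - s a).
have aD s : s \in G -> s != 1%g -> a - s a != 0.
  by move=> sG s1; rewrite -(val_eqy Hw) /= -ltey (lt_le_trans (near s sG s1)) ?leey.
have D0 : D != 0 by apply/prodf_neq0 => s /andP[sG s1]; apply: aD.
have FxD : vcong v ((map_poly iota F).[x] / ((x - j a) * j D)) 1.
  rewrite FE (bigD1 1%g) ?group1 //= gal_id; apply: (vsimM Hv).
    by rewrite divff // vcong_refl.
  rewrite /D rmorph_prod; apply: (vsim_prod Hv) => s /andP[sG s1].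
  rewrite (vcong_div1 Hv) ?fmorph_eq0 ?aD // rmorphB opprB addrA subrK.
  by rewrite -rmorphB near.
have FE' := monic_horner_sub mF mg sF sg rg.
case: (dominant HvK Hv Hext e0 vx (fun i => F`_i - g`_i)) => [H|[l [cl lt _ _]]].
  move/negP: (xa0); case; move: FxD; rewrite FE' big1; last first.
    by move=> i _; rewrite H rmorph0 mul0r.
  by rewrite mul0r /vcong sub0r (valN1 Hv) ltxx.
set c := _ - _ in cl lt.
have x0 : x != 0 by apply: (val_neq0 Hv vx).
have cx0 : iota c * x ^+ l != 0 by rewrite mulf_neq0 ?fmorph_eq0 ?expf_neq0.
have Fx : vcong v ((map_poly iota F).[x] / (iota c * x ^+ l)) 1.
  by rewrite FE' (vcong_div1 Hv).
(* The power of [x] is replaced by that of [a], which has the same leading term, so that the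
   correction lies in L. *)
pose d := (ia c * a ^+ l) / D.
have d0 : d != 0 by rewrite !mulf_neq0 ?invr_eq0 ?expf_neq0 // fmorph_eq0.
have ca0 : ia c * a ^+ l != 0 by rewrite mulf_neq0 ?fmorph_eq0 ?expf_neq0.
have F0 : (map_poly iota F).[x] != 0.
  by apply/eqP => F0; move: Fx; rewrite F0 mul0r /vcong sub0r (valN1 Hv) ltxx.
have xd : vcong v ((x - j a) / j d) 1.
  have jD0 : j D != 0 by rewrite fmorph_eq0.
  suff h : vcong v ((x - j a) * j D / j (ia c * a ^+ l)) 1.
    by rewrite /d fmorph_div invf_div mulrA.
  apply: (vsim_trans Hv F0); first exact: (vsimV Hv).
  apply: (vsim_trans Hv cx0) => //; rewrite rmorphM /= Hj rmorphXn.
  apply: (vsimM Hv); first by rewrite divff ?fmorph_eq0 // vcong_refl.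
  by apply: (vsimX Hv); rewrite (vcong_div1 Hv) // wa.
have jd0 : j d != 0 by rewrite fmorph_eq0.
exists d; split=> //; first exact: (vcong_div1_val Hv).
rewrite (vcong_div1_val Hv jd0 xd) rmorphD opprD addrA.
by rewrite -(vcong_div1 Hv).
Qed.

Variable pi : L.
Hypothesis Hpi : uniformizer w pi.
Variable f : {poly K}.
Hypothesis Hf : map_poly ia f = minPoly 1%VS pi.
Hypothesis HfE : eisenstein vK e f.

Let wpi : v (j pi) = (e%:R^-1)%:E. Proof. exact: totram_uniformizer. Qed.

Lemma root_gal_min (s : gal_of {:L}) : root (map_poly iota f) (j (s pi)).
Proof.
have -> : map_poly iota f = map_poly j (map_poly s (map_poly ia f)).
  rewrite -!map_poly_comp; apply: eq_map_poly => a /=.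
  by rewrite rmorph_alg Hj.
by rewrite !fmorph_root Hf root_minPoly.
Qed.

Lemma gal_inv (s : gal_of {:L}) x : v (j (s x)) = v (j x).
Proof.
apply: (gal_val wpi); apply: (eisenstein_root_val Hv Hext e0 HfE).
exact: root_gal_min.
Qed.

(** The minimal polynomial divides the characteristic polynomial of [pi], and both are monic of
    degree [e]. *)
Lemma min_horner (x : Omega) :
  (map_poly iota f).[x] = \prod_(s in G) (x - j (s pi)).
Proof.
have [F [mF sF FE]] := conj_poly pi; suff -> : f = F by apply: FE.
have [mf sf _ _] := HfE; apply: (@map_poly_inj _ _ ia).
apply/eqP; rewrite -eqp_monic ?map_monic // Hf.
rewrite -dvdp_size_eqp; first by rewrite -Hf !size_map_poly sf sF.
apply: minPoly_dvdp; first by apply/polyOver1P; exists F.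
rewrite -(fmorph_root j) -map_poly_comp /root.
have -> : map_poly (j \o ia) F = map_poly iota F.
  by apply: eq_map_poly => a /=; rewrite Hj.
by rewrite FE (bigD1 1%g) ?group1 //= gal_id subrr mul0r.
Qed.

Hypothesis HK : valuation_complete vK.

(** L is complete, hence closed in Omega: along an approximating sequence each coefficient of the
    expansion in [pi] is Cauchy in K, and the coefficientwise limit is [x]. *)
Lemma totram_complete (x : Omega) :
  (forall N : nat, exists a : L, (N%:R%:E <= v (x - j a))%E) ->
  exists a : L, x = j a.
Proof.
move=> /choice[a aE]; have [c cE] := choice (fun N => totram_expansion wpi (a N)).
have cauchy (i : 'I_e) : exists l : K, forall N : nat, exists n0 : nat,
    forall n : nat, (n0 <= n)%N -> (N%:R%:E <= vK (c n i - l))%E.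
  (* A bound N + 1 on the difference only bounds its i-th coefficient by N + 1 - i/e, whence the
     extra unit. *)
  apply: HK => N; exists N.+1 => m n Nm Nn.
  have : (N.+1%:R%:E <= v (j (\sum_i ia (c m i - c n i) * pi ^+ i)%R))%E.
    have -> : \sum_i ia (c m i - c n i) * pi ^+ i = a m - a n.
      rewrite (cE m) (cE n) -sumrB; apply: eq_bigr => l _.
      by rewrite /= scalerBl mulrBl.
    rewrite rmorphB -[j (a m) - _](subrKA x) addrC -[X in (_ + X)]opprB.
    apply: (val_leB Hv); [apply: le_trans (aE n)|apply: le_trans (aE m)];
      by rewrite lee_fin ler_nat.
  rewrite (totram_le wpi (fun i => c m i - c n i)) => /forallP/(_ i).
  have [->|/(valK_int HvK)[k ->]] := eqVneq (c m i - c n i) 0.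
    by move=> _; rewrite (val0 HvKv) leey.
  rewrite -EFinD !lee_fin -natr1 -lerBrDr -addrA => /le_trans; apply.
  rewrite gerDl subr_le0 ler_pdivrMr // mul1r ler_nat.
  exact: ltnW.
have [l lE] := choice cauchy.
exists (\sum_i ia (l i) * pi ^+ i); apply/eqP; rewrite -subr_eq0 -(val_eqy Hv).
apply/eqP/eqyP => A A0; have [n0 n0E] := choice (fun i => lE i (Num.bound A)).
pose n := maxn (Num.bound A) (\max_i n0 i).
apply: (@le_trans _ _ (Num.bound A)%:R%:E).
  by rewrite lee_fin ltW // archi_boundP // ltW.
rewrite -(subrKA (j (a n))); apply: (val_leD Hv).
  by apply: le_trans (aE n); rewrite lee_fin ler_nat leq_maxl.
have -> : j (a n) - j (\sum_i ia (l i) * pi ^+ i) = j (\sum_i ia (c n i - l i) * pi ^+ i).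
  rewrite -rmorphB {1}(cE n) -sumrB; congr (j _); apply: eq_bigr => i _.
  by rewrite /= scalerBl mulrBl.
rewrite (totram_le wpi (fun i => c n i - l i)); apply/forallP => i.
apply: (@le_trans _ _ ((Num.bound A)%:R%:E + 0)%E); first by rewrite adde0.
apply: leeD; last by rewrite lee_fin divr_ge0 // ltW.
by apply: n0E; rewrite leq_max (leq_bigmax i) orbT.
Qed.

(* A form of Krasner's lemma; since [g] is Eisenstein, successive approximation
   in [L] avoids the uniqueness of extensions of valuations. *)
Lemma close_in_range (g : {poly K}) (x : Omega) (a : L) :
  eisenstein vK e g -> root (map_poly iota g) x -> v (j a) = (e%:R^-1)%:E ->
  ((e%:R^-1)%:E < v (x - j a))%E ->
  {in G, forall s : gal_of {:L}, s != 1%g -> (v (j (a - s a)%R) < v (x - j a))%E} ->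
  exists y : L, x = j y.
Proof.
move=> gE rg wa xa near; have vx := eisenstein_root_val Hv Hext e0 gE rg.
have x0 : x != 0 by apply: (val_neq0 Hv vx).
pose good a := [/\ v (j a) = (e%:R^-1)%:E, ((e%:R^-1)%:E < v (x - j a))%E &
  {in G, forall s : gal_of {:L}, s != 1%g -> (v (j (a - s a)%R) < v (x - j a))%E}].
have step b : good b -> x = j b \/ exists d, [/\ d != 0, v (x - j b) = v (j d),
    (v (x - j b) < v (x - j (b + d)%R))%E & good (b + d)].
  case=> wb xb nb; have [->|[d [d0 vd lt]]] := newton_step gE rg wb xb nb.
    by left.
  right; exists d; split=> //; have lt' := lt_trans xb lt; split=> //.
    rewrite -vx; apply: (vcong_div1_val Hv x0).
    by rewrite (vcong_div1 Hv) // vx -(valN Hv) opprB.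
  (* Both [d] and [d - s d] have valuation at least v(x - b), which exceeds that of [b - s b]. So
     adding [d] cannot bring [b] and its conjugate closer together than v(x - b). *)
  move=> s sG s1; apply: le_lt_trans lt; rewrite vd.
  have vdd : (v (j d) <= v (j (d - s d)%R))%E.
    by rewrite rmorphB; apply: (val_leB Hv); rewrite ?gal_inv.
  rewrite leNgt; apply/negP => /ltW h; have := nb s sG s1; rewrite vd.
  have -> : b - s b = (b + d - s (b + d)) - (d - s d).
    by rewrite (rmorphD s) opprD addrACA addrK.
  by rewrite rmorphB ltNge (val_leB Hv).
(* The distance from [x] to a good [b] is the valuation of the next correction, hence lies in (1/e)
   Z, and every step gains at least 1/e. This is why [step] is applied once more at [b + d]. *)
have approx n : exists2 b, good b & ((n%:R / e%:R)%:E <= v (x - j b))%E.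
  elim: n => [|n [b gb nb]].
    exists a; first by split.
    by rewrite mul0r (le_trans _ (ltW xa)) // lee_fin invr_ge0 ltW.
  have [xb|[d [d0 vd lt gbd]]] := step b gb.
    by exists b => //; rewrite {1}xb subrr (val0 Hv) leey.
  exists (b + d) => //; have [xb|[d' [d'0 vd' _ _]]] := step _ gbd.
    by rewrite {1}xb subrr (val0 Hv) leey.
  have [m mE] := totram_val d0; have [m' mE'] := totram_val d'0.
  move: lt nb; rewrite vd' vd mE mE' lte_fin !lee_fin.
  rewrite ltr_pM2r ?invr_gt0 // !ler_pM2r ?invr_gt0 // ltr_int.
  rewrite -[n%:R]/((Posz n)%:~R) -[n.+1%:R]/((Posz n.+1)%:~R) !ler_int -lezD1.
  by move=> mm nm; apply: le_trans mm; rewrite -addn1 PoszD lerD2r.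
apply: totram_complete => N; have [b _ bE] := approx (N * e)%N.
by exists b; apply: le_trans bE; rewrite lee_fin natrM mulfK // gt_eqF.
Qed.

(** Any element of valuation 1/e generates L over K, since its powers span L. *)
Lemma adjoin_range (y : L) : v (j y) = (e%:R^-1)%:E ->
  adjoin iota (j y) = range j.
Proof.
move=> wy; apply/seteqP; split => z.
  pose S : {pred Omega} := fun z => `[< exists t, z = j t >].
  have SP t : t \in S <-> exists u, t = j u by rewrite /S unfold_in; split => /asboolP.
  move=> zS; have /SP[u ->] : z \in S; [apply: zS | by exists u].
  - split; first by apply/SP; exists 1; rewrite rmorph1.
      by move=> _ _ /SP[t ->] /SP[u ->]; apply/SP; exists (t - u); rewrite rmorphB.
    by move=> _ _ /SP[t ->] /SP[u ->]; apply/SP; exists (t / u); rewrite fmorph_div.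
  - by move=> a; apply/SP; exists (ia a); rewrite /= Hj.
  - by apply/SP; exists y.
case=> t _ <- S [S1 SB SV] Sia Sy.
have S0 : 0 \in S by rewrite -(subrr 1) SB.
have SN u : u \in S -> - u \in S by move=> uS; rewrite -sub0r SB.
have SD u t' : u \in S -> t' \in S -> u + t' \in S.
  by move=> uS tS; rewrite -(opprK t') SB // SN.
have SM u t' : u \in S -> t' \in S -> u * t' \in S.
  by move=> uS tS; rewrite -(invrK t') SV // -div1r SV.
have [c ->] := totram_expansion wy t; rewrite rmorph_sum.
elim/big_rec: _ => // i u _ uS; apply: SD => //.
rewrite rmorphM rmorphXn /= Hj; apply: (SM) => //.
by elim: (i : nat) => [|n IH]; rewrite ?expr0 // exprS SM.
Qed.

(** A K-embedding sends [pi] to a root of [f], that is, to some conjugate [j (s pi)]; so it equals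
    [j] composed with [s], and its image is that of [j]. *)
Lemma K_isomorphic_range (x : Omega) :
  K_isomorphic iota L (adjoin iota x) -> exists y : L, x = j y.
Proof.
case=> tau tauK tauE; have : (adjoin iota x) x by move=> S _ _.
rewrite -tauE => -[t _ <-].
have : root (map_poly iota f) (tau pi).
  have -> : map_poly iota f = map_poly tau (map_poly ia f).
    by rewrite -map_poly_comp; apply: eq_map_poly => a /=; rewrite tauK.
  by rewrite fmorph_root Hf root_minPoly.
rewrite /root min_horner => /prodf_eq0[s sG]; rewrite subr_eq0 => /eqP tpi.
have [c ->] := totram_expansion wpi t.
exists (s (\sum_i ia (c i) * pi ^+ i)); rewrite !rmorph_sum.
apply: eq_bigr => i _; rewrite !rmorphM !rmorphXn /= tpi tauK.
by rewrite rmorph_alg Hj.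
Qed.

(** Integral elements are polynomials in [a] with integral coefficients in K, and s a - a divides (s
    a)^i - a^i; so the infimum is reached at [a]. *)
Lemma ram_iE (a : L) (s : gal_of {:L}) : v (j a) = (e%:R^-1)%:E ->
  ram_i w s = v (j (a - s a)).
Proof.
move=> wa; have wN b : v (j (s b - b)) = v (j (b - s b)).
  by rewrite -(valN Hv) -rmorphN opprB.
apply/le_anti/andP; split.
  apply: ereal_inf_lbound; exists a; rewrite ?wN //.
  by rewrite /val_ring /= wa lee_fin invr_ge0 ltW.
apply: le_ereal_inf_tmp => _ [b + <-]; rewrite /val_ring /=.
have [c ->] := totram_expansion wa b; rewrite (totram_le wa) => /forallP H.
have -> : s (\sum_i ia (c i) * a ^+ i) - \sum_i ia (c i) * a ^+ i =
    \sum_i ia (c i) * (s a ^+ i - a ^+ i).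
  rewrite rmorph_sum -sumrB; apply: eq_bigr => i _.
  by rewrite rmorphM rmorphXn /= rmorph_alg mulrBr.
apply: (val_le_sum Hw) => i _; rewrite -wN subrXX mulrCA !rmorphM.
rewrite (valM Hv); apply: leeDl; apply: (val_intM Hv).
  by rewrite Hj Hext; apply: totram_int_coef (H i).
rewrite rmorph_sum; apply: (val_le_sum Hv) => l _.
have a_int : (0 <= v (j a))%E by rewrite wa lee_fin invr_ge0 ltW.
rewrite rmorphM !rmorphXn; apply: (val_intM Hv); apply: (val_intX Hv) => //.
by rewrite gal_inv.
Qed.

End TotallyRamifiedGalois.

(** * Reduction to the residue field *)

Section Reduction.
Variables (R : realType) (F E : fieldType) (v : F -> \bar R) (Hv : valuation v).
Variable (j : {rmorphism E -> F}).
Variables (k : fieldType) (r : E -> k).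
Hypothesis Hr : is_residue_field (fun x => v (j x)) r.

Local Notation int x := (0 <= v (j x%R))%E.

Let Hw : valuation (fun x => v (j x)). Proof. exact: valuation_comp. Qed.

Lemma int0 : int 0. Proof. by rewrite (val0 Hw) leey. Qed.
Lemma int1 : int 1. Proof. by rewrite (val1 Hw). Qed.
Lemma intN x : int x -> int (- x). Proof. by rewrite (valN Hw). Qed.
Lemma intD x y : int x -> int y -> int (x + y). Proof. exact: (val_leD Hw). Qed.
Lemma intM x y : int x -> int y -> int (x * y). Proof. exact: (val_intM Hw). Qed.

Lemma red1 : r 1 = 1. Proof. by case: Hr. Qed.

Lemma redD x y : int x -> int y -> r (x + y) = r x + r y.
Proof. by case: Hr => _ h _ _ xi yi; case: (h x y xi yi). Qed.

Lemma redM x y : int x -> int y -> r (x * y) = r x * r y.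
Proof. by case: Hr => _ h _ _ xi yi; case: (h x y xi yi). Qed.

Lemma red_eq0 x : int x -> (r x == 0) = (0 < v (j x))%E.
Proof.
move=> xi; case: Hr => _ _ _ /(_ x xi) h.
by apply/eqP/idP => /h.
Qed.

Lemma red0 : r 0 = 0.
Proof. by apply/eqP; rewrite red_eq0 ?int0 // (val0 Hw) ltey. Qed.

Lemma redN x : int x -> r (- x) = - r x.
Proof.
move=> xi; apply/eqP; rewrite -addr_eq0 -redD ?intN //.
by rewrite addNr red0.
Qed.

Lemma redB x y : int x -> int y -> r (x - y) = r x - r y.
Proof. by move=> xi yi; rewrite redD ?intN // redN. Qed.

Lemma red_vcong x y : int x -> int y -> (r x == r y) = vcong v (j x) (j y).
Proof.
move=> xi yi; rewrite -subr_eq0 -redB // red_eq0 ?rmorphB //.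
by apply: (val_leB Hv).
Qed.

Lemma vcong_red x y : int y -> vcong v (j x) (j y) -> r x = r y.
Proof.
by move=> yi h; apply/eqP; rewrite red_vcong //; apply: (vcong_int Hv h).
Qed.

Lemma red_neq0 x : int x -> r x != 0 -> v (j x) = 0%E.
Proof.
by move=> xi; rewrite red_eq0 // -leNgt => h; apply/le_anti; rewrite xi h.
Qed.

Lemma redX x n : int x -> r (x ^+ n) = r x ^+ n.
Proof.
move=> xi; elim: n => [|n IH]; first by rewrite !expr0 red1.
by rewrite !exprS redM ?IH //; apply: (val_intX Hw).
Qed.

Lemma red_nat n : r n%:R = n%:R /\ int n%:R.
Proof.
elim: n => [|n [IH ni]]; first by rewrite red0 int0.
by rewrite -!natr1 redD ?int1 // IH red1; split=> //; apply: intD; rewrite ?int1.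
Qed.

Lemma red_sum (I : Type) (s : seq I) (P : pred I) (G : I -> E) :
  (forall i, P i -> int (G i)) ->
  r (\sum_(i <- s | P i) G i) = \sum_(i <- s | P i) r (G i).
Proof.
move=> h; suff [] : int (\sum_(i <- s | P i) G i) /\
  r (\sum_(i <- s | P i) G i) = \sum_(i <- s | P i) r (G i) by [].
elim/big_rec2: _ => [|i y z Pi [IH <-]]; first by rewrite int0 red0.
by split; [apply: intD | rewrite redD]; rewrite ?h.
Qed.

Lemma red_prod (I : Type) (s : seq I) (P : pred I) (G : I -> E) :
  (forall i, P i -> int (G i)) ->
  r (\prod_(i <- s | P i) G i) = \prod_(i <- s | P i) r (G i).
Proof.
move=> h; suff [] : int (\prod_(i <- s | P i) G i) /\
  r (\prod_(i <- s | P i) G i) = \prod_(i <- s | P i) r (G i) by [].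
elim/big_rec2: _ => [|i y z Pi [IH <-]]; first by rewrite int1 red1.
by split; [apply: intM | rewrite redM]; rewrite ?h.
Qed.

Definition intpoly (p : {poly E}) := forall i, int p`_i.

(** Defined coefficient by coefficient, as [r] is multiplicative and additive only on the valuation
    ring. *)
Definition redpoly (p : {poly E}) : {poly k} := \poly_(i < size p) r p`_i.

Lemma coef_redpoly p i : (redpoly p)`_i = r p`_i.
Proof.
by rewrite coef_poly; case: ltnP => // h; rewrite nth_default // red0.
Qed.

Lemma intpolyM p q : intpoly p -> intpoly q -> intpoly (p * q).
Proof.
move=> hp hq i; rewrite coefM; apply: (val_le_sum Hw) => l _.
exact: intM.
Qed.

Lemma redpolyM p q : intpoly p -> intpoly q ->
  redpoly (p * q) = redpoly p * redpoly q.
Proof.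
move=> hp hq; apply/polyP => i; rewrite coef_redpoly !coefM red_sum => [|l _].
  by apply: eq_bigr => l _; rewrite redM // !coef_redpoly.
exact: intM.
Qed.

Lemma intpolyC a : int a -> intpoly a%:P.
Proof. by move=> ai i; rewrite coefC; case: ifP; rewrite ?int0. Qed.

Lemma redpolyC a : redpoly a%:P = (r a)%:P.
Proof.
by apply/polyP => i; rewrite coef_redpoly !coefC; case: ifP; rewrite ?red0.
Qed.

Lemma intpolyXn n : intpoly 'X^n.
Proof. by move=> i; rewrite coefXn; case: eqP; rewrite ?int0 ?int1. Qed.

Lemma redpolyXn n : redpoly 'X^n = 'X^n.
Proof.
by apply/polyP => i; rewrite coef_redpoly !coefXn; case: eqP; rewrite ?red0 ?red1.
Qed.

Lemma intpolyB p q : intpoly p -> intpoly q -> intpoly (p - q).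
Proof. by move=> hp hq i; rewrite coefB; apply: (val_leB Hw). Qed.

Lemma redpolyB p q : intpoly p -> intpoly q ->
  redpoly (p - q) = redpoly p - redpoly q.
Proof.
by move=> hp hq; apply/polyP => i; rewrite coefB !coef_redpoly coefB redB.
Qed.

Lemma redpoly_prod_XsubC (I : Type) (s : seq I) (P : pred I) (a : I -> E) :
  (forall i, P i -> int (a i)) ->
  intpoly (\prod_(i <- s | P i) ('X - (a i)%:P)) /\
  redpoly (\prod_(i <- s | P i) ('X - (a i)%:P)) =
  \prod_(i <- s | P i) ('X - (r (a i))%:P).
Proof.
move=> h; have hX i : P i -> intpoly ('X - (a i)%:P).
  by move=> Pi; apply: intpolyB; [apply: (intpolyXn 1) | apply/intpolyC/h].
elim/big_rec2: _ => [|i y z Pi [IH <-]].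
  by split; [apply: (intpolyXn 0) | apply: (redpolyXn 0)].
split; first by apply: intpolyM => //; apply: hX.
rewrite redpolyM //; last exact: hX.
rewrite redpolyB; [|exact: (intpolyXn 1)|exact/intpolyC/h].
by rewrite (redpolyXn 1) redpolyC.
Qed.

(** An element [y] of the large field need not have a residue in [k]. An identity over [k] still
    becomes a congruence at [y], because it says that the coefficients of [p - q] lie in the maximal
    ideal. *)
Lemma redpoly_vcong p q (y : F) : intpoly p -> intpoly q ->
  redpoly p = redpoly q -> (0 <= v y)%E ->
  vcong v (map_poly j p).[y] (map_poly j q).[y].
Proof.
move=> hp hq e yi; rewrite (vcong_sub0) vcong0 -hornerN -hornerD -!rmorphB.
rewrite horner_coef; apply: (val_lt_sum Hv) => i _; apply: (val_idealM Hv).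
  rewrite coef_map /= -red_eq0; last exact: intpolyB.
  by rewrite -coef_redpoly redpolyB // e subrr coef0.
exact: (val_intX Hv).
Qed.

End Reduction.

(** * Residues of the Galois action, tame and wild *)

Section RamificationResidue.
Variables (R : realType) (K : fieldType) (vK : K -> \bar R).
Hypotheses (HvK : normalized_discrete_valuation vK) (HK : valuation_complete vK).
Variables (k : fieldType) (res : K -> k) (Hres : is_residue_field vK res).
Variables (p : nat) (Hp : p \in [pchar k]).
Variables (Omega : fieldType) (iota : {rmorphism K -> Omega}).
Variables (v : Omega -> \bar R) (Hv : valuation v).
Hypothesis Hext : forall a : K, v (iota a) = vK a.
Variables (L : splittingFieldType K) (j : {rmorphism L -> Omega}).
Hypothesis Hj : forall a : K, j a%:A = iota a.
Hypothesis HGal : galois 1%VS {:L}%VS.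
Variable e : nat.
Hypothesis He : \dim {:L}%VS = e.
Hypothesis Htot : totally_ramified (fun x : L => v (j x)).
Variables (pi : L) (f : {poly K}).
Hypothesis Hpi : uniformizer (fun x : L => v (j x)) pi.
Hypothesis Hf : map_poly (in_alg L) f = minPoly 1%VS pi.
Hypothesis HfE : eisenstein vK e f.

Local Notation w := (fun x : L => v (j x)).
Local Notation G := ('Gal({:L} / 1)%g).
Local Notation ia := (in_alg L).
Local Notation int x := (0 <= v (j x%R))%E.

Let e0 : (0 < e)%N. Proof. by rewrite -He adim_gt0. Qed.
Let eR : (0 : R) < e%:R. Proof. by rewrite ltr0n. Qed.
Let Hw : valuation w. Proof. exact: valuation_comp. Qed.
Let w_ia a : v (j (ia a)) = vK a. Proof. by rewrite /= Hj. Qed.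
Let wpi : v (j pi) = (e%:R^-1)%:E. Proof. exact: (totram_uniformizer Hv He). Qed.
Let inv (s : gal_of {:L}) x : v (j (s x)) = v (j x).
Proof. exact: (gal_inv HvK Hv Hext Hj He Htot Hpi Hf HfE). Qed.
Let expansion := totram_expansion HvK Hv Hext Hj He wpi.

Let HresI : is_residue_field (fun a => v (iota a)) res.
Proof.
have -> : (fun a => v (iota a)) = vK by apply/funext => a; rewrite Hext.
exact: Hres.
Qed.

(** The residue extension being trivial, [rL x] is [res] of a chosen element of K congruent to [x],
    and the choice does not matter. *)
Lemma totram_residue_field : exists rL : L -> k,
  is_residue_field w rL /\ forall a, (0 <= vK a)%E -> rL (ia a) = res a.
Proof.
have lift x : exists a, int x -> (0 <= vK a)%E /\ vcong v (j x) (iota a).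
  have [h|h] := leP 0%E (v (j x)); last by exists 0.
  by have [a] := totram_residue HvK Hv Hext Hj He wpi h; exists a.
have [l lE] := choice lift; exists (res \o l).
have lab x a : int x -> (0 <= vK a)%E -> vcong v (j x) (iota a) -> res (l x) = res a.
  move=> xi ai h; have [li lx] := lE x xi.
  apply: (vcong_red Hv HresI); rewrite ?Hext //.
  exact: (vcong_trans Hv (vcong_sym Hv lx)).
have HvKv : valuation vK by case: HvK.
split; last first.
  by move=> a ai /=; apply: lab; rewrite ?w_ia //= Hj vcong_refl.
split=> /=.
- rewrite (lab 1 1) ?rmorph1 ?vcong_refl ?(val1 Hv) ?(val1 HvKv) //.
  by case: Hres.
- move=> x y xi yi; have [lx xl] := lE x xi; have [ly yl] := lE y yi.
  case: Hres => _ /(_ _ _ lx ly)[<- <-] _ _; split; apply: lab.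
  + exact: (intD Hv).
  + exact: (val_leD HvKv).
  + by rewrite !rmorphD; apply: (vcongD Hv).
  + exact: (intM Hv).
  + exact: (val_intM HvKv).
  by rewrite !rmorphM; apply: (vcongM Hv); rewrite ?Hext.
- move=> c; case: Hres => _ _ /(_ c)[a ai ac] _.
  exists (ia a); first by rewrite /val_ring /= w_ia.
  by rewrite -ac; apply: lab; rewrite ?w_ia //= Hj vcong_refl.
move=> x xi; have [li lx] := lE x xi.
case: Hres => _ _ _ /(_ _ li) ->; rewrite /val_max_ideal /= -Hext -!vcong0.
split; first exact: (vcong_trans Hv lx).
exact: (vcong_trans Hv (vcong_sym Hv lx)).
Qed.

Variable rL : L -> k.
Hypothesis HrL : is_residue_field w rL.
Hypothesis rLK : forall a, (0 <= vK a)%E -> rL (ia a) = res a.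

Lemma residue_lift (c : k) : exists a : K,
  [/\ (0 <= vK a)%E, res a = c & c != 0 -> vK a = 0%E].
Proof.
case: (Hres) => _ _ /(_ c)[a ai ac] _; exists a; split=> // c0.
by rewrite -Hext; apply: (red_neq0 HresI); rewrite ?Hext // ac.
Qed.

Lemma gal_faithful (s : gal_of {:L}) : s pi = pi -> s = 1%g.
Proof.
move=> spi; apply/eqP/gal_eqP => x _; rewrite gal_id.
have [c ->] := expansion x; rewrite rmorph_sum; apply: eq_bigr => i _.
by rewrite rmorphM rmorphXn /= rmorph_alg spi.
Qed.

(** Modulo the maximal ideal [x] comes from K, which [t] fixes. *)
Lemma red_gal (t : gal_of {:L}) x : int x -> rL (t x) = rL x.
Proof.
move=> xi; have [a ai h] := totram_residue HvK Hv Hext Hj He wpi xi.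
apply: (vcong_red Hv HrL) => //; apply: (vcong_trans Hv _ (vcong_sym Hv h)).
rewrite /vcong -Hj; have <- : t a%:A = a%:A by rewrite rmorph_alg.
by rewrite -(rmorphB j) -(rmorphB t) inv rmorphB Hj.
Qed.

(** If T = c pi^l is the leading term of [z], then t T / T = (t pi / pi)^l is congruent to 1, and
    [t z / t T] is congruent to 1 because [t] preserves valuations. *)
Lemma wild_inertia (t : gal_of {:L}) : (v (j pi) < v (j (pi - t pi)%R))%E ->
  forall z, z != 0 -> (v (j z) < v (j (t z - z)%R))%E.
Proof.
move=> wt z z0; have [c zE] := expansion z.
have pi0 : pi != 0 by apply: (val_neq0 Hw wpi).
case: (dominant HvK Hw w_ia e0 wpi c) => [c0|[l [cl]]].
  by case/eqP: z0; rewrite zE big1 // => i _; rewrite c0 rmorph0 mul0r.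
rewrite -zE => lt _ _; set T := _ * _ in lt.
have T0 : T != 0 by rewrite mulf_neq0 ?fmorph_eq0 ?expf_neq0.
have zT : vcong w (z / T) 1 by rewrite (vcong_div1 Hw).
have tzT : vcong w (t z / t T) 1.
  by rewrite (vcong_div1 Hw) ?fmorph_eq0 //= -rmorphB !inv.
have tT : vcong w (t T / T) 1.
  have -> : t T = ia (c l) * t pi ^+ l by rewrite rmorphM rmorphXn /= rmorph_alg.
  apply: (vsimM Hw).
    by rewrite divff ?fmorph_eq0 // vcong_refl.
  apply: (vsimX Hw); rewrite (vcong_div1 Hw) // /=.
  by rewrite -[X in (_ < X)%E](valN Hv) -rmorphN opprB.
rewrite -(vcong_div1 Hw _ z0); apply: (vsim_trans Hw T0); last exact: (vsimV Hw).
by apply: (vsim_trans Hw _ tzT tT); rewrite fmorph_eq0.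
Qed.

Local Notation zeta s := (s pi / pi).

Lemma zeta_val (s : gal_of {:L}) : v (j (zeta s)) = 0%E.
Proof.
have pi0 : pi != 0 by apply: (val_neq0 Hw wpi).
by rewrite (val_div Hw) //= inv wpi -EFinB subrr.
Qed.

Let zint (s : gal_of {:L}) : int (zeta s). Proof. by rewrite zeta_val. Qed.

(** The cocycle s pi / pi becomes a homomorphism because G acts trivially on residues. This is the
    tame character, whose kernel [red_zeta1] describes. *)
Lemma red_zetaM (s t : gal_of {:L}) :
  rL (zeta (s * t)%g) = rL (zeta s) * rL (zeta t).
Proof.
have pi0 : pi != 0 by apply: (val_neq0 Hw wpi).
rewrite -(red_gal t (zint s)) -(redM HrL) ?inv //; congr (rL _).
by rewrite galMe fmorph_div mulrA divfK ?fmorph_eq0.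
Qed.

Lemma red_zeta1 (s : gal_of {:L}) :
  (rL (zeta s) == 1) = (v (j pi) < v (j (pi - s pi)%R))%E.
Proof.
have pi0 : pi != 0 by apply: (val_neq0 Hw wpi).
rewrite -(red1 HrL) (red_vcong Hv HrL) ?zint ?(int1 Hv) //.
have -> : vcong v (j (zeta s)) (j 1) = vcong w (zeta s) 1.
  by rewrite /vcong /= rmorphB.
by rewrite (vcong_div1 Hw) //= -[X in (_ < X)%E](valN Hv) -rmorphN opprB.
Qed.

Lemma val_gal_sub (s : gal_of {:L}) : (v (j pi) <= v (j (pi - s pi)%R))%E.
Proof. by rewrite rmorphB; apply: (val_leB Hv); rewrite ?inv. Qed.

(** If [s] fixed the leading term of [pi], then (s^n pi - pi) / (s pi - pi) would be congruent to n
    for all n, by [wild_inertia]. Taking for n the order of [s] would make p divide that order,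
    hence [e]. *)
Lemma tame_val (s : gal_of {:L}) : ~~ (p %| e)%N -> s \in G -> s != 1%g ->
  v (j (pi - s pi)) = (e%:R^-1)%:E.
Proof.
move=> pe sG s1; rewrite -wpi; apply/le_anti; rewrite val_gal_sub andbT leNgt.
apply/negP => ws; pose d := s pi - pi.
have d0 : d != 0 by rewrite subr_eq0; apply: contra_neq s1 => /gal_faithful.
have zE n : vcong w (((s ^+ n)%g pi - pi) / d) n%:R.
  elim: n => [|n IH].
    by rewrite expg0 gal_id subrr mul0r (vcong_refl Hw).
  have [_ ni] := red_nat Hv HrL n.
  have -> : (s ^+ n.+1)%g pi - pi = (s ((s ^+ n)%g pi - pi) - ((s ^+ n)%g pi - pi)) +
      ((s ^+ n)%g pi - pi) + d.
    by rewrite subrK expgSr galMe rmorphB /d addrA subrK.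
  rewrite 2!mulrDl divff // -natr1 -[n%:R]add0r.
  apply: (vcongD Hw); last exact: (vcong_refl Hw).
  apply: (vcongD Hw) => //; set z := (s ^+ n)%g pi - pi in IH *.
  rewrite vcong0 -(val_lt_div Hw) //.
  have [z0|z0] := eqVneq z 0.
    by rewrite z0 rmorph0 subrr (val0 Hw); apply/(val_ltyP Hw).
  apply: (le_lt_trans _ (wild_inertia ws z0)).
  by rewrite (val_le_div Hw) //; apply: (vcong_int Hw IH).
have := zE #[s]%g; rewrite expg_order gal_id subrr mul0r => h.
have [rn ni] := red_nat Hv HrL #[s]%g.
have : rL 0 = rL #[s]%g%:R.
  by apply: (vcong_red Hv HrL) => //; rewrite /vcong -rmorphB.
rewrite (red0 Hv HrL) rn => /esym/eqP; rewrite -(dvdn_pcharf Hp) => ps.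
by case/negP: pe; apply: dvdn_trans ps _; rewrite -(card_gal HGal He) order_dvdG.
Qed.

(** Cauchy's theorem gives an element of order p; its tame character is a p-th root of unity in
    characteristic p, hence 1. *)
Lemma wild_val : (p %| e)%N -> exists2 s : gal_of {:L}, s \in G &
  s != 1%g /\ (v (j pi) < v (j (pi - s pi)%R))%E.
Proof.
have pp := pcharf_prime Hp; rewrite -(card_gal HGal He) => /(Cauchy pp)[s sG os].
exists s => //; split; first by rewrite -order_gt1 os prime_gt1.
rewrite -red_zeta1; have zX n : rL (zeta (s ^+ n)%g) = rL (zeta s) ^+ n.
  elim: n => [|n IH].
    have pi0 : pi != 0 by apply: (val_neq0 Hw wpi).
    by rewrite expg0 gal_id divff // (red1 HrL).
  by rewrite expgS red_zetaM IH exprS.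
have := zX p; rewrite -{1}os expg_order gal_id divff ?(red1 HrL); last first.
  exact: (val_neq0 Hw wpi).
rewrite -(pFrobenius_autE Hp) -{1}(pFrobenius_aut1 Hp) => h.
rewrite eq_sym; apply/eqP; exact: fmorph_inj h.
Qed.

Let rami (b : L) (s : gal_of {:L}) : v (j b) = (e%:R^-1)%:E ->
  ram_i w s = v (j (b - s b)).
Proof. exact: (ram_iE HvK Hv Hext Hj He Htot Hpi Hf HfE). Qed.

Lemma ram_i1 : ram_i w (1%g : gal_of {:L}) = +oo%E.
Proof. by rewrite (rami _ wpi) gal_id subrr (val0 Hw). Qed.

Lemma ram_i_ge (s : gal_of {:L}) : ((e%:R^-1)%:E <= ram_i w s)%E.
Proof. by rewrite (rami _ wpi) -wpi val_gal_sub. Qed.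

Lemma ram_i_fin (s : gal_of {:L}) : s != 1%g -> (ram_i w s < +oo)%E.
Proof.
move=> s1; rewrite (rami _ wpi); apply/(val_ltyP Hw).
by rewrite subr_eq0 eq_sym; apply: contra_neq s1 => /gal_faithful.
Qed.

Lemma ram_max : (1 < e)%N -> exists s0 : gal_of {:L}, [/\ s0 \in G, s0 != 1%g &
  {in G, forall s : gal_of {:L}, s != 1%g -> (ram_i w s <= ram_i w s0)%E}].
Proof.
rewrite -(card_gal HGal He) cardG_gt1 => /trivgPn[s1 s1G s11].
pose P s := (s \in G) && (s != 1%g).
have Ps1 : P s1 by rewrite /P s1G.
case: (@arg_maxP _ _ _ s1 P (fun s => ram_i w s) Ps1) => s0 /andP[s0G s01] smax.
by exists s0; split=> // s sG sn1; apply: smax; rewrite /P sG.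
Qed.

(* For [v h] the largest finite value of [ram_i], this element has valuation [u_{L/K}],
   and it is the fixed factor relating [f(x)] to the polynomial [P] of the header. *)
Definition break_elt (b h : L) : L :=
  \prod_(s in G) (if (v (j h) <= ram_i w s)%E then h else b - s b).

(** The factor at [s] has valuation min(v h, i(s)), so the total is [ram_trunc] at the largest
    finite i(s), which is the break. *)
Lemma ram_break_val (b h : L) (s0 : gal_of {:L}) : v (j b) = (e%:R^-1)%:E ->
  s0 \in G -> s0 != 1%g -> v (j h) = ram_i w s0 ->
  {in G, forall s : gal_of {:L}, s != 1%g -> (ram_i w s <= ram_i w s0)%E} ->
  v (j (break_elt b h)) = (ram_break w)%:E.
Proof.
move=> wb s0G s01 wh smax; have ri0 s : s \in G -> (0 < ram_i w s)%E.
  by move=> _; apply: lt_le_trans (ram_i_ge s); rewrite lte_fin invr_gt0.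
have rfin s : s \in G -> s != 1%g -> (ram_i w s < +oo)%E by move=> _; apply: ram_i_fin.
have hfin : v (j h) = (fine (v (j h)))%:E.
  by rewrite wh fineK // ge0_fin_numE ?rfin // ltW // ri0.
rewrite (ram_breakE ram_i1 ri0 rfin s0G s01 _ (c := fine (v (j h)))); first last.
- by move=> s sG s1; rewrite -hfin wh smax.
- by rewrite -hfin wh.
apply: (val_prod Hw) => s sG; rewrite -hfin; case: ifP => // /negbT.
rewrite -ltNge => lt; rewrite -(rami s wb) fineK // ge0_fin_numE ?(ltW (ri0 _ _)) //.
by apply: lt_trans lt _; rewrite hfin ltry.
Qed.

(** * The product of the x - s b for x near an element b of valuation 1/e *)

Section Base.
Variables (b h : L).
Hypotheses (wb : v (j b) = (e%:R^-1)%:E) (h0 : h != 0).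

Local Notation Fb x := (\prod_(s in G) (x - j (s b))).

Lemma break_elt_neq0 : break_elt b h != 0.
Proof.
apply/prodf_neq0 => s sG; case: ifP => // /negbT; rewrite -ltNge => lt.
by apply/(val_ltyP Hw); rewrite -(rami s wb) (lt_le_trans lt) ?leey.
Qed.

(** Suppose v(x - b) < v h. As [b] is the conjugate closest to [x], each x - s b has valuation at
    most that of the factor of [break_elt] at [s], strictly less at s = 1, so the product is too
    large. *)
Lemma near_root (x : Omega) : (v (j (break_elt b h)) <= v (Fb x))%E ->
  {in G, forall s : gal_of {:L}, (v (x - j (s b)) <= v (x - j b))%E} ->
  (v (j h) <= v (x - j b))%E.
Proof.
move=> le near; rewrite leNgt; apply/negP => lt.
have xs0 s : s \in G -> x - j (s b) != 0.
  move=> sG; apply/(val_ltyP Hv); apply: (le_lt_trans (near s sG)).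
  by apply: lt_le_trans lt _; rewrite leey.
have F0 : Fb x != 0 by apply/prodf_neq0.
move: le; apply/negP; rewrite -ltNge (val_lt_div Hv) // /break_elt rmorph_prod.
rewrite -prodf_div (bigD1 1%g) ?group1 //= ram_i1 leey gal_id.
apply: (val_idealM Hv); first by rewrite -(val_lt_div Hv) // -[b](gal_id {:L}) xs0 ?group1.
apply: (val_int_prod Hv) => s /andP[sG _]; rewrite -(val_le_div Hv) ?xs0 //.
case: ifP => _; first by apply: le_trans (near s sG) (ltW lt).
have -> : j (b - s b) = (x - j (s b)) - (x - j b).
  by rewrite rmorphB opprB [RHS]addrC subrKA.
by apply: (val_leB Hv) => //; apply: near.
Qed.

(** Put y = (x - b) / h. A factor with i(s) >= v h gives exactly y - theta s; for the others, x - s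
    b has leading term b - s b and the quotient is congruent to 1. *)
Lemma break_quotient (x : Omega) : (v (j h) <= v (x - j b))%E ->
  vcong v (Fb x / j (break_elt b h))
    (\prod_(s in G | (v (j h) <= ram_i w s)%E) ((x - j b) / j h - j ((s b - b) / h))).
Proof.
move=> le; have jh0 : j h != 0 by rewrite fmorph_eq0.
rewrite /break_elt rmorph_prod -prodf_div [X in vcong _ _ X]big_mkcondr /=.
have xh s : (x - j b) / j h - j ((s b - b) / h) = (x - j (s b)) / j h.
  rewrite fmorph_div -mulrBl rmorphB; congr (_ / _).
  by rewrite opprB subrKA.
apply: (vcong_prod Hv) => s sG; case: ifP => hs; rewrite ?(val1 Hv) //.
- rewrite xh -(val_le_div Hv) //.
  have -> : x - j (s b) = (x - j b) + j (b - s b) by rewrite rmorphB subrKA.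
  by apply: (val_leD Hv) => //; rewrite -(rami s wb).
- by rewrite xh vcong_refl.
move/negbT: hs; rewrite -ltNge (rami s wb) => lt.
have bs0 : j (b - s b) != 0.
  by apply/(val_ltyP Hv); apply: lt_le_trans lt _; rewrite leey.
rewrite (vcong_div1 Hv) // rmorphB opprB addrA subrK.
by rewrite -rmorphB (lt_le_trans lt).
Qed.

Hypothesis whb : (v (j b) < v (j h))%E.

Definition last_ram : {set gal_of {:L}} := [set s in G | (v (j h) <= ram_i w s)%E]%SET.

Let theta (s : gal_of {:L}) := (s b - b) / h.

Let ths (s : gal_of {:L}) : (v (j h) <= ram_i w s)%E -> int (theta s).
Proof.
move=> hs; rewrite /theta -(val_le_div Hw) //= -[X in (_ <= X)%E](valN Hv).
by rewrite -rmorphN opprB -(rami s wb).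
Qed.

Lemma last_ram_group_set : group_set last_ram.
Proof.
apply/group_setP; split; first by rewrite inE group1 ram_i1 leey.
move=> s t; rewrite !inE => /andP[sG hs] /andP[tG ht]; rewrite groupM //=.
move: hs ht; rewrite !(rami _ wb) => hs ht.
have -> : b - (s * t)%g b = (b - t b) + t (b - s b).
  by rewrite galMe rmorphB subrKA.
by rewrite rmorphD; apply: (val_leD Hv); rewrite ?inv.
Qed.
Canonical last_ram_group := Group last_ram_group_set.

Definition last_char (s : gal_of {:L}) : k := rL (theta s).

Hypothesis hmax :
  {in G, forall s : gal_of {:L}, s != 1%g -> (ram_i w s <= v (j h))%E}.

(** With d = s b - b, the defect of additivity is (t d - d) / h. Here v d >= v h, and [t] is wild
    because v b < v h, so t d - d has valuation greater than v h. *)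
Lemma last_charM :
  {in last_ram &, forall s t, last_char (s * t)%g = last_char s + last_char t}.
Proof.
move=> s t; rewrite !inE => /andP[sG hs] /andP[tG ht].
rewrite /last_char -(redD HrL) ?ths //.
apply: (vcong_red Hv HrL); first by apply: (intD Hv); apply: ths.
rewrite /vcong -rmorphB; set d := s b - b.
have -> : theta (s * t)%g - (theta s + theta t) = (t d - d) / h.
  rewrite /theta galMe -/d -mulrDl -mulrBl; congr (_ / _).
  by rewrite /d rmorphB; ring.
rewrite -(val_lt_div Hw) //=.
have [->|d0] := eqVneq d 0; first by rewrite rmorph0 subrr (val0 Hw); apply/(val_ltyP Hw).
apply: le_lt_trans (wild_inertia _ d0).
  by rewrite -[X in (_ <= X)%E](valN Hv) -rmorphN opprB -(rami s wb).
by rewrite -(rami t wpi) wpi -wb (lt_le_trans whb).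
Qed.

(** A zero residue for s <> 1 would push i(s) above the maximum v h. *)
Lemma last_char_inj : {in last_ram, forall s, last_char s = 0 -> s = 1%g}.
Proof.
move=> s; rewrite !inE => /andP[sG hs] /eqP; rewrite (red_eq0 HrL) ?ths //.
rewrite -(val_lt_div Hw) //= -[X in (_ < X)%E](valN Hv) -rmorphN opprB.
rewrite -(rami s wb) => lt; apply/eqP/negPn/negP => s1.
by move: lt; rewrite ltNge hmax.
Qed.

(* When [P(c) = - z] in [k], the roots of [P - z] are the [theta s - c], so they all
   lie in [k]. *)
Lemma wild_solve (z : L) (y : Omega) :
  (forall a : k, exists c : k, a = (grpoly last_char last_ram_group).[c]) ->
  int z -> (0 <= v y)%E ->
  vcong v (\prod_(s in last_ram) (y - j (theta s))) (j z) ->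
  exists c : L, vcong v y (j c).
Proof.
move=> surj zi yi yz; have [c cE] := surj (- rL z).
have [a [ai ac _]] := residue_lift c.
have iai : int (ia a) by rewrite w_ia.
have thi s : s \in last_ram -> int (theta s) by rewrite inE => /andP[_]; apply: ths.
have thai s : s \in last_ram -> int (theta s - ia a).
  by move=> sH; rewrite rmorphB; apply: (val_leB Hv) => //; apply: thi.
have [i1 r1] := redpoly_prod_XsubC Hv HrL (index_enum _) thi.
have [i2 r2] := redpoly_prod_XsubC Hv HrL (index_enum _) thai.
have e1 : map_poly j (\prod_(s in last_ram) ('X - (theta s - ia a)%:P)) =
    \prod_(s in last_ram) ('X - (j (theta s - ia a))%:P).
  by rewrite rmorph_prod; apply: eq_bigr => s _; rewrite rmorphB /= map_polyX map_polyC.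
have e2 : map_poly j (\prod_(s in last_ram) ('X - (theta s)%:P)) =
    \prod_(s in last_ram) ('X - (j (theta s))%:P).
  by rewrite rmorph_prod; apply: eq_bigr => s _; rewrite rmorphB /= map_polyX map_polyC.
have iz := intpolyC Hv zi.
have er : redpoly rL (\prod_(s in last_ram) ('X - (theta s - ia a)%:P)) =
    redpoly rL (\prod_(s in last_ram) ('X - (theta s)%:P) - z%:P).
  rewrite r2 (redpolyB Hv HrL i1 iz) r1 (redpolyC Hv HrL) -polyCN cE.
  rewrite -(grpoly_transl last_charM last_char_inj).
  by apply: eq_bigr => s sH; rewrite (redB Hv HrL) ?thi // rLK // ac.
have : vcong v (\prod_(s in last_ram) (y - j (theta s - ia a))) 0.
  have := redpoly_vcong Hv HrL i2 (intpolyB Hv i1 iz) er yi.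
  rewrite e1 rmorphB /= e2 map_polyC hornerD hornerN hornerC !horner_prod.
  rewrite (eq_bigr _ (fun s _ => hornerXsubC _ y)).
  rewrite (eq_bigr _ (fun s _ => hornerXsubC _ y)) => h1.
  by apply: (vcong_trans Hv h1); rewrite -vcong_sub0.
move=> /(vcong_prime Hv) [s sH|s sH].
  by apply: (val_leB Hv) => //; apply: thai.
by rewrite -vcong_sub0 => h1; exists (theta s - ia a).
Qed.

Hypothesis Fbf : forall x, (map_poly iota f).[x] = Fb x.

(** The leading term c x^l of f(x) - g(x) is also that of c b^l, which lies in L. So the quotient
    that [break_quotient] compares with P(y) has a residue in [k]. *)
Lemma break_leading (g : {poly K}) (x : Omega) : eisenstein vK e g ->
  root (map_poly iota g) x -> ((e%:R^-1)%:E < v (x - j b))%E ->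
  (v (j (break_elt b h)) <= v (Fb x))%E ->
  exists2 z, int z & vcong v (Fb x / j (break_elt b h)) (j z).
Proof.
move=> gE rg xb le; have vx := eisenstein_root_val Hv Hext e0 gE rg.
have [mg sg _ _] := gE; have [mf sf _ _] := HfE.
have FE := monic_horner_sub mf mg sf sg rg; rewrite Fbf in FE.
have E0 : j (break_elt b h) != 0 by rewrite fmorph_eq0 break_elt_neq0.
case: (dominant HvK Hv Hext e0 vx (fun i => f`_i - g`_i)) => [H|[l [cl lt vl _]]].
  exists 0; first exact: (int0 Hv).
  rewrite FE big1 ?mul0r ?rmorph0 ?vcong_refl // => i _.
  by rewrite H rmorph0 mul0r.
rewrite -FE in lt vl; set c := _ - _ in cl lt vl.
have x0 : x != 0 by apply: (val_neq0 Hv vx).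
have b0 : b != 0 by apply: (val_neq0 Hw wb).
have jb0 : j b != 0 by rewrite fmorph_eq0.
have cx0 : iota c * x ^+ l != 0 by rewrite mulf_neq0 ?fmorph_eq0 ?expf_neq0.
pose u := ia c * b ^+ l.
have u0 : u != 0 by rewrite mulf_neq0 ?fmorph_eq0 ?expf_neq0.
have ju0 : j u != 0 by rewrite fmorph_eq0.
have Fu : vcong v (Fb x / j u) 1.
  apply: (vsim_trans Hv cx0); first by rewrite (vcong_div1 Hv).
  rewrite rmorphM /= Hj rmorphXn; apply: (vsimM Hv).
    by rewrite divff ?fmorph_eq0 // vcong_refl.
  by apply: (vsimX Hv); rewrite (vcong_div1 Hv) // wb.
have zi : int (u / break_elt b h).
  rewrite -(val_le_div Hw) ?break_elt_neq0 //=.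
  by rewrite -(vcong_div1_val Hv ju0 Fu).
exists (u / break_elt b h) => //.
have -> : Fb x / j (break_elt b h) = Fb x / j u * j (u / break_elt b h).
  by rewrite fmorph_div mulrA divfK.
rewrite -[X in vcong _ _ X]mul1r.
by apply: (vcongM Hv); rewrite ?(val1 Hv) ?vcong_refl.
Qed.

End Base.

Let close := close_in_range HvK Hv Hext Hj HGal He Htot Hpi Hf HfE HK.

Let minE := min_horner Hj HGal He Hf HfE.

(** * The wildly ramified case *)

Lemma wild_break : (p %| e)%N -> exists h : L, exists s0 : gal_of {:L},
  [/\ s0 \in G, s0 != 1%g, v (j h) = ram_i w s0, h != 0 &
   (v (j pi) < v (j h))%E /\
   {in G, forall s : gal_of {:L}, s != 1%g -> (ram_i w s <= v (j h))%E}].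
Proof.
move=> pe; have pp := pcharf_prime Hp.
have e1 : (1 < e)%N by apply: leq_trans (prime_gt1 pp) (dvdn_leq e0 pe).
have [s0 [s0G s01 smax]] := ram_max e1; exists (pi - s0 pi), s0.
have wh : v (j (pi - s0 pi)) = ram_i w s0 by rewrite (rami _ wpi).
split=> //.
  by apply/(val_ltyP Hw); rewrite /= wh ram_i_fin.
(* Wildness provides some [s1] with i(s1) > v pi, so the maximum v h exceeds v pi. *)
rewrite wh; split=> //; have [s1 s1G [s11 lt]] := wild_val pe.
by apply: lt_le_trans lt _; rewrite -(rami _ wpi) smax.
Qed.

Lemma wild_backward (g : {poly K}) (x : Omega) : (p %| e)%N ->
  (forall a : k, exists c : k, a = c ^+ p - c) ->
  eisenstein vK e g -> ((ram_break w)%:E <= poly_val vK e f g)%E ->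
  root (map_poly iota g) x -> exists y : L, x = j y.
Proof.
move=> pe wp gE fg rg; have vx := eisenstein_root_val Hv Hext e0 gE rg.
have [h [s0 [s0G s01 wh h0 [wh1 hmax]]]] := wild_break pe.
pose P (s : gal_of {:L}) := s \in G.
have P1 : P 1%g by rewrite /P group1.
(* The base point [b] is the conjugate of [pi] closest to [x]; recentring there only permutes the
   factors of f. *)
case: (@arg_maxP _ _ _ 1%g P (fun s => v (x - j (s pi))) P1) => t tG tmax.
pose b := t pi; have wb : v (j b) = (e%:R^-1)%:E by rewrite inv.
have Fbf y : (map_poly iota f).[y] = \prod_(s in G) (y - j (s b)).
  rewrite minE (reindex_inj (mulgI t)); apply: eq_big => [s|s _].
    by rewrite groupMl.
  by rewrite galMe.
have near : {in G, forall s : gal_of {:L}, (v (x - j (s b)) <= v (x - j b))%E}.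
  by move=> s sG; rewrite -galMe; apply: tmax; rewrite /P groupM.
have [mg sg _ _] := gE; have [mf sf _ _] := HfE.
have le : (v (j (break_elt b h)) <= v (\prod_(s in G) (x - j (s b))))%E.
  rewrite -Fbf -(poly_valE HvK Hv Hext e0 vx mf mg sf sg rg).
  rewrite (ram_break_val wb s0G s01 wh) // => s sG s1.
  by rewrite -wh hmax.
have lexb := near_root le near.
have whb : (v (j b) < v (j h))%E by rewrite wb -wpi.
have xb : ((e%:R^-1)%:E < v (x - j b))%E by rewrite -wb (lt_le_trans whb).
have [z zi zE] := break_leading wb h0 Fbf gE rg xb le.
have jh0 : j h != 0 by rewrite fmorph_eq0.
pose y := (x - j b) / j h.
have yi : (0 <= v y)%E by rewrite -(val_le_div Hv).
have H1 : last_ram_group h wb :!=: 1%g.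
  apply/trivgPn; exists s0 => //; rewrite inE s0G -wh lexx //.
have surj := (grpoly_surj Hp (last_charM wb h0 whb)
  (last_char_inj wb h0 hmax) H1).1 wp.
have [|c cE] := wild_solve h0 whb hmax surj zi yi.
  apply: (vcong_trans Hv _ zE); apply: (vcong_sym Hv).
  under [X in vcong _ _ X]eq_bigl do rewrite inE.
  exact: (break_quotient wb h0 lexb).
(* Since (x - b) / h is congruent to c, v(x - a) > v h; and v h bounds every i(s) with s <> 1. So
   [x] is closer to [a] than the conjugates of [a] are. *)
pose a := b + c * h.
have xa : (v (j h) < v (x - j a))%E.
  rewrite (val_lt_div Hv) // rmorphD rmorphM opprD addrA mulrBl mulfK //.
have xa' : ((e%:R^-1)%:E < v (x - j a))%E by rewrite -wpi (lt_trans wh1).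
have x0 : x != 0 by apply: (val_neq0 Hv vx).
have wa : v (j a) = (e%:R^-1)%:E.
  rewrite -vx; apply: (vcong_div1_val Hv x0).
  by rewrite (vcong_div1 Hv) // vx -(valN Hv) opprB.
apply: (close gE rg wa xa') => s sG s1.
by rewrite -(rami s wa) (le_lt_trans (hmax s sG s1)).
Qed.

(** Compare factor by factor with [pi ^+ e], of valuation 1; the gain is strict at s = 1. Hence
    u_{L/K} > 1 in the wild case, which keeps perturbations of f at that depth Eisenstein. *)
Lemma break_elt_gt1 (h : L) : (v (j pi) < v (j h))%E ->
  (1 < v (j (break_elt pi h)))%E.
Proof.
move=> wh; have pi0 : pi != 0 by apply: (val_neq0 Hw wpi).
have <- : v (j (\prod_(s in G) pi)) = 1%E.
  rewrite prodr_const (card_gal HGal He) rmorphXn (valXn Hv _ wpi) divff //.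
  by rewrite gt_eqF.
rewrite (val_lt_div Hw) /=; last by apply/prodf_neq0 => s _.
rewrite /break_elt -prodf_div (bigD1 1%g) ?group1 //= ram_i1 leey rmorphM.
apply: (val_idealM Hv); first by rewrite -(val_lt_div Hw).
rewrite rmorph_prod; apply: (val_int_prod Hv) => s _.
rewrite -(val_le_div Hw) //=; case: ifP => _; first exact: ltW.
exact: val_gal_sub.
Qed.

Lemma eisenstein_perturb (c : K) (l : nat) (n : ssrint.int) : (l < e)%N ->
  vK c = (n%:~R)%:E -> 1 <= n -> ((l == 0)%N -> vK (f`_0 + c) = 1%E) ->
  eisenstein vK e (f + c *: 'X^l).
Proof.
move=> le vc n1 l0; have [/monicP mf sf fi f0] := HfE.
have HvKv : valuation vK by case: HvK.
have sc : (size (c *: 'X^l) < size f)%N.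
  by rewrite sf ltnS (leq_trans (size_scale_leq _ _)) // size_polyXn.
split.
- by rewrite qualifE /= lead_coefDl // mf.
- by rewrite size_polyDl.
- move=> i ie; rewrite coefD coefZ coefXn; apply: (val_leD HvKv); first exact: fi.
  case: eqP => _; rewrite ?mulr1 ?mulr0 ?(val0 HvKv) ?leey // vc lee_fin.
  by rewrite ler1z.
rewrite coefD coefZ coefXn eq_sym; case: eqP => /= [/eqP|] h.
  by rewrite mulr1 l0.
by rewrite mulr0 addr0.
Qed.

(** To reach a residue [al], take g = f + c X^l with c pi^l of valuation u_{L/K} and - c pi^l /
    [break_elt] of residue [al]. By (T) a root y of g lies in L; there f(y) = - c y^l, so the
    residue of (y - pi) / h is sent to [al] by P. *)
Lemma wild_forward : (p %| e)%N ->
  (forall q : {poly Omega}, (1 < size q)%N -> exists x, root q x) ->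
  property_T vK iota L e f (ram_break w) ->
  forall a : k, exists c : k, a = c ^+ p - c.
Proof.
move=> pe Hcl HT; have [h [s0 [s0G s01 wh h0 [whb hmax]]]] := wild_break pe.
have H1 : last_ram_group h wpi :!=: 1%g.
  by apply/trivgPn; exists s0 => //; rewrite inE s0G -wh lexx.
apply: (grpoly_surj Hp (last_charM wpi h0 whb) (last_char_inj wpi h0 hmax) H1).2.
(* Zero is set apart, since the construction below needs a unit [A]; it is the value of P at theta
   1. *)
move=> al; have [->|al0] := eqVneq al 0.
  exists (last_char pi h 1%g).
  by rewrite (grpoly_th _ (group1 (last_ram_group h wpi))).
have HvKv : valuation vK by case: HvK.
have pi0 : pi != 0 by apply: (val_neq0 Hw wpi).
set E := break_elt pi h; have E0 : E != 0 := break_elt_neq0 wpi h0.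
have vE : v (j E) = (ram_break w)%:E.
  by apply: (ram_break_val wpi s0G s01 wh) => s sG s1; rewrite -wh hmax.
have [m mE] := totram_val He Htot E0.
(* Division of m by e writes the valuation m/e of [E] as n + l/e, that of a term a0 pi^l. *)
pose n := (m %/ Posz e)%Z; pose l := `|(m %% Posz e)%Z|%N.
have ez : Posz e != 0 by rewrite eqz_nat -lt0n.
have lE : Posz l = (m %% Posz e)%Z by rewrite /l gez0_abs // modz_ge0.
have le : (l < e)%N by rewrite -ltz_nat lE ltz_pmod.
have mnl : m = n * Posz e + Posz l by rewrite lE -divz_eq.
have me : Posz e < m.
  have := break_elt_gt1 whb; rewrite -/E mE lte_fin ltr_pdivlMr // mul1r.
  by rewrite -[e%:R]/((Posz e)%:~R) ltr_int.
have [a0 a00 va0] := valK_ex HvK n.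
have vE' : v (j E) = (n%:~R + l%:R / e%:R)%:E.
  rewrite mE mnl; congr (_%:E); rewrite intrD intrM mulrDl mulfK ?gt_eqF //.
pose u := ia a0 * pi ^+ l.
have u0 : u != 0 by rewrite mulf_neq0 ?fmorph_eq0 ?expf_neq0.
have vu : v (j u) = v (j E).
  by rewrite vE' -(val_term Hw w_ia wpi l va0).
pose q := E / u; have vq : v (j q) = 0%E.
  by rewrite (val_div Hw) //= vu vE -EFinB subrr.
have qi : int q by rewrite vq.
have rq0 : rL q != 0 by rewrite (red_eq0 HrL) // vq ltxx.
(* The factor [rL q] compensates the ratio q of [E] to a0 pi^l, so that - A / q has residue [al]. *)
have [A [Ai rA vA]] := residue_lift (- al * rL q).
have {}vA : vK A = 0%E by apply: vA; rewrite mulf_neq0 // oppr_eq0.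
pose c := a0 * A; have vc : vK c = (n%:~R)%:E by rewrite (valM HvKv) vA adde0.
have A0 : A != 0 by apply: (@val_neq0 _ _ _ HvKv _ 0); rewrite vA.
have n1 : 1 <= n.
  rewrite leNgt; apply/negP => n0; move: me; apply/negP; rewrite -leNgt mnl.
  have : n <= 0 by rewrite -ltzD1 add0r.
  move=> n0'; rewrite -[Posz e]add0r lerD ?lez_nat 1?ltnW //.
  by rewrite mulr_le0_ge0.
have gE : eisenstein vK e (f + c *: 'X^l).
  (* If l = 0, then m = n e > e forces n >= 2, and the constant coefficient keeps valuation 1. *)
  apply: (eisenstein_perturb le vc n1) => /eqP l0; have [_ _ _ f0] := HfE.
  have f00 : f`_0 != 0 by apply: (@val_neq0 _ _ _ HvKv _ 1).
  rewrite -f0; apply: (vcong_div1_val HvKv f00).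
  rewrite (vcong_div1 HvKv) // addrAC subrr add0r f0 vc lte_fin.
  rewrite ltr1z ltNge; apply/negP => n2.
  by move: me; rewrite mnl l0 addr0 ltNge => /negP; apply; rewrite ler_piMl.
set g := _ + _ in gE.
have fg : ((ram_break w)%:E <= poly_val vK e f g)%E.
  apply: le_bigmin; rewrite ?leey // => i _.
  rewrite /g coefD opprD addrA subrr add0r (valN HvKv) coefZ coefXn -vE vE'.
  case: eqP => [->|_]; first by rewrite mulr1 vc -EFinD.
  by rewrite mulr0 (val0 HvKv) leey.
have [mg sg _ _] := gE.
have [x rx] : exists x, root (map_poly iota g) x.
  by apply: Hcl; rewrite size_map_poly sg ltnS.
have [y0 xy] := K_isomorphic_range HvK Hv Hext Hj HGal He Htot Hpi Hf HfE (HT g gE fg x rx).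
pose P (s : gal_of {:L}) := s \in G.
have P1 : P 1%g by rewrite /P group1.
case: (@arg_maxP _ _ _ 1%g P (fun s => v (j (y0 - s pi))) P1) => t tG tmax.
(* The root is moved, rather than [pi]: [pi] becomes the conjugate closest to [y], and [y] is still
   a root of g. *)
pose y := (t^-1)%g y0.
have ty : t y = y0 by rewrite /y -galMe mulVg gal_id.
have near : {in G, forall s : gal_of {:L}, (v (j y - j (s pi)) <= v (j y - j pi))%E}.
  have yE (s : gal_of {:L}) : v (j y - j (s pi)) = v (j (y0 - (s * t)%g pi)).
    have -> : y0 - (s * t)%g pi = t (y - s pi) by rewrite rmorphB galMe -ty.
    by rewrite inv rmorphB.
  move=> s sG; have := yE 1%g; rewrite gal_id mul1g => ->; rewrite yE.
  by apply: tmax; rewrite /P groupM.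
have giA : map_poly iota g = map_poly j (map_poly ia g).
  by rewrite -map_poly_comp; apply: eq_map_poly => a' /=; rewrite Hj.
have ry : root (map_poly iota g) (j y).
  have tg : map_poly t (map_poly ia g) = map_poly ia g.
    by rewrite -map_poly_comp; apply: eq_map_poly => a' /=; rewrite rmorph_alg.
  by move: rx; rewrite giA xy !fmorph_root -ty -{1}tg fmorph_root.
have Fy : (map_poly iota f).[j y] = - (iota c * j y ^+ l).
  move/rootP: ry; rewrite /g rmorphD /= map_polyZ map_polyXn hornerD hornerZ hornerXn.
  by move/eqP; rewrite addr_eq0 => /eqP.
have vy := eisenstein_root_val Hv Hext e0 gE ry.
have leF : (v (j E) <= v (\prod_(s in G) (j y - j (s pi))))%E.
  rewrite -minE Fy (valN Hv) vE' -(val_term Hv Hext vy l vc) //.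
have lexb := near_root leF near.
have quo := break_quotient wpi h0 lexb.
have xb : ((e%:R^-1)%:E < v (j y - j pi))%E by rewrite -wpi (lt_le_trans whb).
pose z := (y - pi) / h.
have zi : int z by rewrite -(val_le_div Hw) //= rmorphB.
exists (rL z); rewrite grpolyE.
have thi s : s \in last_ram h -> int ((s pi - pi) / h).
  rewrite inE => /andP[_ hs]; rewrite -(val_le_div Hw) //= -[X in (_ <= X)%E](valN Hv).
  by rewrite -rmorphN opprB -(rami s wpi).
have -> : \prod_(s in last_ram_group h wpi) (rL z - last_char pi h s) =
    rL (\prod_(s in last_ram h) (z - (s pi - pi) / h)).
  rewrite (red_prod Hv HrL) => [|s sH]; last first.
    by rewrite rmorphB; apply: (val_leB Hv) => //; apply: thi.
  by apply: eq_bigr => s sH; rewrite (redB Hv HrL) ?thi.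
have Aqi : int (- (ia A / q)).
  rewrite rmorphN (valN Hv) fmorph_div (val_div Hv) ?fmorph_eq0; last first.
    by rewrite mulf_neq0 ?invr_eq0.
  by rewrite vq w_ia vA sube0.
have -> : al = rL (- (ia A / q)).
  have q0 : q != 0 by rewrite mulf_neq0 ?invr_eq0.
  apply: (mulIf rq0); rewrite -(redM HrL) // mulNr divfK // (redN Hv HrL) ?w_ia //.
  by rewrite rLK // rA mulNr opprK.
symmetry; apply: (vcong_red Hv HrL) => //.
apply: (vcong_trans Hv (y := (\prod_(s in G) (j y - j (s pi))) / j E)).
  apply: (vcong_sym Hv).
  have -> : j (\prod_(s in last_ram h) (z - (s pi - pi) / h)) =
      \prod_(s in G | (v (j h) <= ram_i w s)%E)
        ((j y - j pi) / j h - j ((s pi - pi) / h)).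
    rewrite rmorph_prod; apply: eq_big => [s|s _]; first by rewrite inE.
    by rewrite rmorphB /z fmorph_div rmorphB.
  exact: quo.
rewrite -minE Fy rmorphN mulNr; apply: (vcongN Hv).
rewrite rmorphN (valN Hv) in Aqi.
have jE : j (ia A / q) = iota c * j pi ^+ l / j E.
  rewrite /q /u invf_div mulrA fmorph_div !rmorphM rmorphXn /= !Hj.
  by rewrite mulrA (mulrC (iota A)).
have jpi0 : j pi ^+ l != 0 by rewrite expf_neq0 ?fmorph_eq0.
(* Replacing y^l by pi^l changes nothing modulo the maximal ideal, as [y] and [pi] have the same
   leading term. *)
have -> : iota c * j y ^+ l / j E = j (ia A / q) * (j y ^+ l / j pi ^+ l).
  rewrite jE; move: jpi0; move: (j pi ^+ l) (j y ^+ l) => P' Y' P0.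
  by field; rewrite P0 fmorph_eq0.
rewrite -[X in vcong _ _ X]mulr1; apply: (vcongM Hv); rewrite ?(val1 Hv) ?vcong_refl //.
apply: (vsimX Hv); rewrite (vcong_div1 Hv) ?fmorph_eq0 //.
by rewrite (lt_le_trans whb).
Qed.

(** * The tamely ramified case *)

Section Tame.
Hypothesis pe : ~~ (p %| e)%N.

Let pi0 : pi != 0. Proof. exact: (val_neq0 Hw wpi). Qed.
Let jpi0 : j pi != 0. Proof. by rewrite fmorph_eq0. Qed.

(** Tameness makes the tame character injective, so its values are e distinct roots of X^e - 1 in
    [k]. *)
Lemma zeta_prod (y : Omega) : (0 <= v y)%E ->
  vcong v (\prod_(s in G) (y - j (zeta s))) (y ^+ e - 1).
Proof.
move=> yi.
have [i1 r1] := redpoly_prod_XsubC Hv HrL (index_enum _)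
  (fun (s : gal_of {:L}) (_ : s \in G) => zint s).
have i2 : intpoly v j ('X^e - 1%:P).
  by apply: (intpolyB Hv); [apply: intpolyXn | apply/intpolyC/int1].
have er : redpoly rL (\prod_(s in G) ('X - (zeta s)%:P)) = redpoly rL ('X^e - 1%:P).
  rewrite r1 (redpolyB Hv HrL); [|exact: intpolyXn|exact/intpolyC/int1].
  rewrite (redpolyXn Hv HrL) (redpolyC Hv HrL) (red1 HrL) polyC1.
  rewrite -(card_gal HGal He).
  apply: (@prod_injective_character _ _ _ (fun s : gal_of {:L} => rL (zeta s))).
  - by move=> s t _ _; apply: red_zetaM.
  - move=> s sG /eqP; rewrite red_zeta1 => lt; apply/eqP/negPn/negP => s1.
    by move: lt; rewrite (tame_val pe sG s1) wpi ltxx.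
  by rewrite gal_id divff // (red1 HrL).
have := redpoly_vcong Hv HrL i1 i2 er yi.
rewrite rmorph_prod rmorphB /= map_polyXn map_polyC /= rmorph1 hornerD hornerN hornerC.
rewrite hornerXn horner_prod; congr (is_true (vcong v _ _)).
by apply: eq_bigr => s _; rewrite rmorphB /= map_polyX map_polyC hornerXsubC.
Qed.

Let horner_div (x : Omega) : (map_poly iota f).[x] / j pi ^+ e =
  \prod_(s in G) (x / j pi - j (zeta s)).
Proof.
rewrite minE -(card_gal HGal He) -prodr_const -prodf_div.
by apply: eq_bigr => s _; rewrite fmorph_div mulrBl.
Qed.

(** By [zeta_prod], f(x) / pi^e is congruent to (x / pi)^e - 1. In f(x) - g(x) only the constant
    term has valuation as small as 1, and f_0 / pi^e is congruent to -1, by [zeta_prod] at 0. *)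
Lemma tame_root (g : {poly K}) (x : Omega) : eisenstein vK e g ->
  root (map_poly iota g) x -> vcong v ((x / j pi) ^+ e) (iota (g`_0 / f`_0)).
Proof.
move=> gE rg; have vx := eisenstein_root_val Hv Hext e0 gE rg.
have HvKv : valuation vK by case: HvK.
have [mg sg gi vg0] := gE; have [mf sf fi vf0] := HfE.
have f00 : f`_0 != 0 by apply: (@val_neq0 _ _ _ HvKv _ 1).
have xi : (0 <= v (x / j pi))%E by rewrite -(val_le_div Hv) // vx wpi.
have vpie : v (j pi ^+ e) = 1%E.
  by rewrite (valXn Hv _ wpi) divff // gt_eqF.
have pie0 : j pi ^+ e != 0 by rewrite expf_neq0.
have c0 : vcong v (iota f`_0 / j pi ^+ e) (-1).
  have := zeta_prod (y := 0); rewrite (val0 Hv) leey => /(_ isT).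
  rewrite expr0n gtn_eqF // sub0r; apply: (vcong_trans Hv).
  have := horner_div 0; rewrite horner_coef0 coef_map mul0r /= => ->.
  exact: vcong_refl.
have cx := zeta_prod xi; rewrite -horner_div in cx.
have lt : vcong v ((map_poly iota f).[x] / j pi ^+ e)
    (iota (f`_0 - g`_0) / j pi ^+ e).
  rewrite /vcong -mulrBl -(val_lt_div Hv) // vpie.
  rewrite (monic_horner_sub mf mg sf sg rg) -(prednK e0) big_ord_recl expr0 mulr1.
  rewrite addrAC subrr add0r; apply: (val_lt_sum Hv) => i _.
  have ie : (i.+1 < e)%N by rewrite -[X in (_ < X)%N](prednK e0) ltnS.
  rewrite (val_termE Hv Hext vx); apply: (@lt_le_trans _ _ (1 + (i.+1%:R / e%:R)%:E)%E).
    by rewrite -EFinD lte_fin ltrDl divr_gt0 // ltr0n.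
  by apply: leeD2r; apply: (val_leB HvKv); [apply: fi | apply: gi].
have e1 : iota (f`_0 - g`_0) / j pi ^+ e =
    iota ((f`_0 - g`_0) / f`_0) * (iota f`_0 / j pi ^+ e).
  by rewrite fmorph_div mulrA divfK ?fmorph_eq0.
have qi : (0 <= v (iota ((f`_0 - g`_0) / f`_0)%R))%E.
  rewrite Hext -(val_le_div HvKv) //; apply: (val_leB HvKv) => //.
  by rewrite vf0 vg0.
have lt' : vcong v (iota (f`_0 - g`_0) / j pi ^+ e) (iota (g`_0 / f`_0) - 1).
  have -> : iota (g`_0 / f`_0) - 1 = iota ((f`_0 - g`_0) / f`_0) * (-1).
    by rewrite mulrBl divff // rmorphB rmorph1 mulrN1 opprB.
  rewrite e1; apply: (vcongM Hv) => //; first by rewrite (valN1 Hv).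
  exact: vcong_refl.
have := vcong_trans Hv (vcong_sym Hv cx) (vcong_trans Hv lt lt').
by rewrite /vcong opprB addrA subrK.
Qed.

(** Let B lift an e-th root of the residue of g_0 / f_0. Then x / (pi B) has e-th power congruent to
    1, so it is congruent to some [zeta s]. Thus [x] is at distance more than 1/e from B s pi, whose
    conjugates are at distance exactly 1/e. *)
Lemma tame_backward (g : {poly K}) (x : Omega) :
  (forall a : k, a != 0 -> exists2 b : k, b != 0 & a = b ^+ e) ->
  eisenstein vK e g -> root (map_poly iota g) x -> exists y : L, x = j y.
Proof.
move=> he gE rg; have vx := eisenstein_root_val Hv Hext e0 gE rg.
have HvKv : valuation vK by case: HvK.
have [_ _ _ vg0] := gE; have [_ _ _ vf0] := HfE.
have f00 : f`_0 != 0 by apply: (@val_neq0 _ _ _ HvKv _ 1).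
pose u := g`_0 / f`_0; have vu : vK u = 0%E.
  by rewrite (val_div HvKv) // vg0 vf0 -EFinB subrr.
have ru : res u != 0 by rewrite (red_eq0 HresI) Hext vu // ltxx.
have [b b0 bE] := he _ ru; have [B [Bi rB /(_ b0) vB]] := residue_lift b.
have B0 : iota B != 0 by rewrite fmorph_eq0; apply: (@val_neq0 _ _ _ HvKv _ 0).
have Be0 : iota B ^+ e != 0 by rewrite expf_neq0.
have vBe : v (iota B ^+ e) = 0%E.
  by rewrite (valXn Hv (r := 0)) ?mulr0 // Hext vB.
pose y := x / j pi / iota B.
have xi : (0 <= v (x / j pi))%E by rewrite -(val_le_div Hv) // vx wpi.
have yi : (0 <= v y)%E by rewrite -(val_le_div Hv) // Hext vB.
have uB : vcong v (iota u) (iota B ^+ e).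
  rewrite -rmorphXn -(red_vcong Hv HresI) ?Hext ?vu //.
    by rewrite (redX Hv HresI) ?Hext // bE rB.
  by rewrite -Hext rmorphXn vBe.
have ye : vcong v (y ^+ e) 1.
  rewrite /y expr_div_n (vcong_div1 Hv) // vBe.
  exact: (vcong_trans Hv (tame_root gE rg) uB).
have : vcong v (\prod_(s in G) (y - j (zeta s))) 0.
  by apply: (vcong_trans Hv (zeta_prod yi)); rewrite -vcong_sub0.
move=> /(vcong_prime Hv)[s sG|s sG].
  by apply: (val_leB Hv) => //; apply: zint.
rewrite -vcong_sub0 => ys; pose a := ia B * s pi.
have wa : v (j a) = (e%:R^-1)%:E by rewrite rmorphM /= Hj (valM Hv) Hext vB add0e inv.
have xa : ((e%:R^-1)%:E < v (x - j a))%E.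
  have -> : x - j a = (y - j (zeta s)) * (j pi * iota B).
    rewrite rmorphM /= Hj fmorph_div mulrBl /y; field.
    by rewrite jpi0 B0.
  rewrite (valM Hv) (valM Hv) Hext vB adde0 wpi.
  by rewrite lteDr.
apply: (close_in_range HvK Hv Hext Hj HGal He Htot Hpi Hf HfE HK gE rg wa xa) => t tG t1.
rewrite -(rami t wa) (rami t wpi) (tame_val pe tG t1) //.
Qed.

(** Here [h = pi] is allowed, every factor of [break_elt] is then [pi], and pi^e has valuation 1. *)
Lemma tame_break : (1 < e)%N -> ram_break w = 1.
Proof.
move=> e1; have [s0 [s0G s01 smax]] := ram_max e1.
have wh : v (j pi) = ram_i w s0 by rewrite (rami s0 wpi) (tame_val pe s0G s01).
have := ram_break_val wpi s0G s01 wh smax.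
have -> : break_elt pi pi = pi ^+ e.
  rewrite -(card_gal HGal He) -prodr_const; apply: eq_bigr => s _.
  by rewrite wpi ram_i_ge.
rewrite rmorphXn (valXn Hv _ wpi) divff ?gt_eqF // => -[<-] //.
Qed.

(** Let A lift [a] and let g be f with constant coefficient A f_0. Two Eisenstein polynomials
    satisfy v_K(f, g) >= 1, so (T) puts a root x of g in L, and by [tame_root] the residue of x / pi
    is an e-th root of [a]. *)
Lemma tame_forward : (1 < e)%N ->
  (forall q : {poly Omega}, (1 < size q)%N -> exists x, root q x) ->
  property_T vK iota L e f (ram_break w) ->
  forall a : k, a != 0 -> exists2 b : k, b != 0 & a = b ^+ e.
Proof.
move=> e1 Hcl HT a a0; have HvKv : valuation vK by case: HvK.
have [_ _ fi vf0] := HfE.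
have f00 : f`_0 != 0 by apply: (@val_neq0 _ _ _ HvKv _ 1).
have [A [Ai rA /(_ a0) vA]] := residue_lift a.
have A0 : A != 0 by apply: (@val_neq0 _ _ _ HvKv _ 0); rewrite vA.
pose c := (A - 1) * f`_0.
have cf : f`_0 + c = A * f`_0 by rewrite /c mulrBl mul1r addrC subrK.
have vc : (1 <= vK c)%E.
  rewrite (valM HvKv) vf0 -[leLHS]add0e; apply: leeD => //.
  by apply: (val_leB HvKv); rewrite ?vA ?(val1 HvKv).
have gE : eisenstein vK e (f + c *: 'X^0).
  have [c0|c0] := eqVneq c 0; first by rewrite c0 scale0r addr0.
  have [n nE] := valK_int HvK c0.
  apply: (eisenstein_perturb e0 nE) => [|_].
    by move: vc; rewrite nE lee_fin ler1z.
  by rewrite cf (valM HvKv) vA vf0 add0e.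
set g := _ + _ in gE.
have g0 : g`_0 / f`_0 = A.
  by rewrite /g coefD coefZ coefXn mulr1 cf mulfK.
have [mg sg gi vg0] := gE.
have fg : ((ram_break w)%:E <= poly_val vK e f g)%E.
  rewrite tame_break //; apply: le_bigmin; rewrite ?leey // => i _.
  rewrite -[leLHS]adde0; apply: leeD; last by rewrite lee_fin divr_ge0 // ltW.
  by apply: (val_leB HvKv); [apply: fi | apply: gi].
have [x rx] : exists x, root (map_poly iota g) x.
  by apply: Hcl; rewrite size_map_poly sg ltnS.
have [y xy] := K_isomorphic_range HvK Hv Hext Hj HGal He Htot Hpi Hf HfE (HT g gE fg x rx).
have := tame_root gE rx; rewrite g0 xy -fmorph_div -rmorphXn -Hj.
have vy := eisenstein_root_val Hv Hext e0 gE rx; rewrite xy in vy.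
have yi : int (y / pi) by rewrite -(val_le_div Hw) //= vy wpi.
move/(vcong_red Hv HrL); rewrite w_ia => /(_ Ai).
rewrite (redX Hv HrL) // rLK // rA => h.
exists (rL (y / pi)) => //; apply: contraNneq a0 => y0.
by rewrite -h y0 expr0n gtn_eqF.
Qed.

End Tame.

End RamificationResidue.

(** * The two equivalences, with roots taken in the algebraically closed field Omega *)

Theorem corollary5p3 (R : realType)
  (K : fieldType) (vK : K -> \bar R)
  (HvK : normalized_discrete_valuation vK) (HK : valuation_complete vK)
  (k : fieldType) (res : K -> k) (Hres : is_residue_field vK res)
  (p : nat) (Hp : p \in [pchar k])
  (Omega : closedFieldType) (iota : {rmorphism K -> Omega})
  (Halg : forall x : Omega, algebraicOver iota x)
  (v : Omega -> \bar R) (Hv : valuation v)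
  (Hext : forall a : K, v (iota a) = vK a)
  (L : splittingFieldType K) (j : {rmorphism L -> Omega})
  (Hj : forall a : K, j a%:A = iota a)
  (HGal : galois 1%VS {:L}%VS)
  (Htot : totally_ramified (fun x : L => v (j x)))
  (e : nat) (He : \dim {:L}%VS = e)
  (HLK : {:L}%VS <> 1%VS)
  (piL : L) (HpiL : uniformizer (fun x : L => v (j x)) piL)
  (f : {poly K}) (Hf : map_poly (in_alg L) f = minPoly 1%VS piL)
  (HfE : eisenstein vK e f) :
  (tamely_ramified (fun x : L => v (j x)) p ->
     (property_T vK iota L e f (ram_break (fun x : L => v (j x))) <->
      (forall a : k, a != 0 -> exists2 b : k, b != 0 & a = b ^+ e))) /\
  (wildly_ramified (fun x : L => v (j x)) p ->
     (property_T vK iota L e f (ram_break (fun x : L => v (j x))) <->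
      (forall a : k, exists b : k, a = b ^+ p - b))).
Proof.
have e0 : (0 < e)%N by rewrite -He adim_gt0.
have e1 : (1 < e)%N.
  rewrite ltn_neqAle e0 andbT eq_sym; apply/eqP => e_1; apply: HLK.
  by symmetry; apply/eqP; rewrite eqEdim sub1v He dimv1 e_1 /=.
have [rL [HrL rLK]] := totram_residue_field HvK Hres Hv Hext Hj He Htot HpiL.
have Hcl (q : {poly Omega}) : (1 < size q)%N -> exists x, root q x.
  by move=> sq; apply/closed_rootP; rewrite gtn_eqF.
(* A root of an Eisenstein g that lies in the image of [j] has valuation 1/e, so it generates this
   image and [j] itself is the isomorphism required. *)
have back (g : {poly K}) (x : Omega) : eisenstein vK e g ->
    root (map_poly iota g) x -> (exists y : L, x = j y) ->
    K_isomorphic iota L (adjoin iota x).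
  move=> gE rg [y xy]; rewrite xy in rg *; exists j => //.
  have vy := eisenstein_root_val Hv Hext e0 gE rg.
  by rewrite (adjoin_range HvK Hv Hext Hj He vy).
split; case=> _; rewrite He => pe; split.
- exact: (tame_forward HvK Hres Hp Hv Hext Hj HGal He Htot HpiL Hf HfE HrL rLK pe e1 Hcl).
- move=> he g gE _ x rg; apply: (back g x gE rg).
  exact: (tame_backward HvK HK Hres Hp Hv Hext Hj HGal He Htot HpiL Hf HfE HrL pe he gE rg).
- exact: (wild_forward HvK Hres Hp Hv Hext Hj HGal He Htot HpiL Hf HfE HrL rLK pe Hcl).
- move=> he g gE fg x rg; apply: (back g x gE rg).
  exact: (wild_backward HvK HK Hres Hp Hv Hext Hj HGal He Htot HpiL Hf HfE HrL rLK pe he gE fg rg).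
Qed.
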